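(* Assume that $d=1$ and that $f$ and $g$ do not depend on $t\in[0,T]$. Let $W(f,g)=g'f-f'g$ be the Wronskian of $f$ and $g$. If $f$ is of class $C^2$ and $$\forall x\in\mathbb R,\qquad |W(f,g)(x)|>\tfrac12\|f''\|_\infty\|g\|_\infty^2,$$ then, conditionally on $\{N_T\ge1\}$, the law of $X_T$ is absolutely continuous with respect to the Lebesgue measure on $\mathbb R$.
   Context: Fix $T>0$. $N$ is a nonlinear Hawkes process on $(\Omega,\mathcal F,\mathbb P)$ (with $\Omega$ the canonical space of càdlàg counting paths started at $0$ with unit jumps), i.e. a counting process with conditional intensity, with respect to its natural filtration, $\lambda^*(t)=\lambda_t+\gamma\big(\int_{(0,t)}\mu(t-s)\,dN_s\big)$. Standing assumptions: $\lambda:\mathbb R_+\to(0,\infty)$ is differentiable with bounded derivative and $\lambda_t\ge\lambda_*>0$ for all $t$; $\mu:\mathbb R_+\to\mathbb R_+$ is $C^1$ with bounded derivative and in $L^1([0,\infty))$; $\gamma:\mathbb R_+\to\mathbb R_+$ is $C^1$ with bounded derivative, $\gamma(0)=0$; and $\sup_{x\ge0}|\gamma'(x)|\int_0^\infty\mu(t)\,dt<1$. $X$ is the unique solution of the SDE $X_t=x_0+\int_0^tf(s,X_s)\,ds+\int_{(0,t]}g(s,X_{s-})\,dN_s$, $0\le t\le T$, with $x_0\in\mathbb R^d$, where $f,g:[0,T]\times\mathbb R^d\to\mathbb R^d$ are measurable and: (1) for each $t$, $f(t,\cdot)$ and $g(t,\cdot)$ are $C^1$; (2) $\sup_{t,x}(|\nabla_xf(t,x)|+|\nabla_xg(t,x)|)<\infty$;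 (3) for each $x$, $g(\cdot,x)$ is differentiable; (4) $\det(I_d+\nabla_xg(t,x))\ne0$ for all $(t,x)\in[0,T]\times\mathbb R^d$ and $(I_d+\nabla_xg)^{-1}$ is uniformly bounded. Here $d=1$ and one writes $f(x),g(x)$ for $f(t,x),g(t,x)$. *)

(* Defs.v *)
From HB Require Import structures.
From mathcomp Require Import all_boot all_order all_algebra.
From mathcomp Require Import all_classical all_reals all_analysis.

Set Implicit Arguments.
Unset Strict Implicit.
Unset Printing Implicit Defensive.

Import Order.TTheory GRing.Theory Num.Theory.
Import numFieldNormedType.Exports.

Local Open Scope ring_scope.
Local Open Scope classical_set_scope.

(* A function on R_+ is represented by a function on R of which only the
   values on [0, +oo[ are used; its derivative is the limit of the difference
   quotient along [0, +oo[, hence one-sided at 0. *)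

Definition halfline {R : realType} : set R := `[0, +oo[.

Definition derivable_halfline {R : realType} (h : R -> R) : Prop :=
  forall t, 0 <= t -> cvg ((h s - h t) / (s - t) @[s --> within halfline t^']).

Definition derive_halfline {R : realType} (h : R -> R) (t : R) : R :=
  lim ((h s - h t) / (s - t) @[s --> within halfline t^']).

Definition C1_halfline {R : realType} (h : R -> R) : Prop :=
  derivable_halfline h /\ {within halfline, continuous (derive_halfline h)}.

Definition bounded_derive_halfline {R : realType} (h : R -> R) : Prop :=
  exists K : R, forall t, 0 <= t -> `|derive_halfline h t| <= K.

Definition C1 {R : realType} (h : R -> R) : Prop :=
  (forall x, derivable h x 1) /\ continuous (derive1 h).

Definition C2 {R : realType} (h : R -> R) : Prop := C1 h /\ C1 (derive1 h).

(* Possibly +oo; products of such norms follow 0 * +oo = 0. *)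
Definition sup_norm {R : realType} (h : R -> R) : \bar R :=
  ereal_sup (range (fun x => `|h x|%:E)).

(* Counting paths are indexed by R_+; the extension by 0 to negative times
   makes the representation unique. The existence of left limits follows from
   monotonicity. *)
Record counting_path (R : realType) := CountingPath {
  path_val : R -> nat;
  path_val0 : forall t, t <= 0 -> path_val t = 0%N;
  path_val_homo : {homo path_val : s t / s <= t >-> (s <= t)%N};
  path_val_right : forall t, \forall s \near t^'+, path_val s = path_val t;
  path_val_unit : forall t, \forall s \near t^'-,
    (path_val t <= (path_val s).+1)%N }.

HB.instance Definition _ (R : realType) := gen_eqMixin (counting_path R).
HB.instance Definition _ (R : realType) := gen_choiceMixin (counting_path R).

Section zero_path.
Variable R : realType.

Let val0 (t : R) : t <= 0 -> (fun=> 0%N) t = 0%N. Proof. by []. Qed.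
Let val_homo : {homo (fun _ : R => 0%N) : s t / s <= t >-> (s <= t)%N}.
Proof. by []. Qed.
Let val_right (t : R) : \forall s \near t^'+, (fun=> 0%N) s = (fun=> 0%N) t.
Proof. by apply: nearW. Qed.
Let val_unit (t : R) :
  \forall s \near t^'-, ((fun=> 0%N) t <= ((fun=> 0%N) s).+1)%N.
Proof. by apply: nearW. Qed.

Definition zero_path := CountingPath val0 val_homo val_right val_unit.

HB.instance Definition _ := isPointed.Build (counting_path R) zero_path.
End zero_path.

Definition cylinders {R : realType} (I : set R) : set (set (counting_path R)) :=
  [set A | exists t (k : nat), I t /\ A = [set w | path_val w t = k]].

Notation Omega R := (g_sigma_algebraType (@cylinders R setT)).

Definition N {R : realType} (t : R) (w : Omega R) : nat := path_val w t.

Definition natural_filtration {R : realType} (t : R) : set (set (Omega R)) :=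
  <<s cylinders [set s | s <= t] >>.

Definition jump_times {R : realType} (w : Omega R) : set R :=
  [set t | \forall s \near t^'-, N t w = (N s w).+1].

(* int_D h(s) dN_s, for h real-valued and D bounded (so that N has finitely
   many jumps in D). *)
Definition int_dN {R : realType} (D : set R) (h : R -> R) (w : Omega R) : R :=
  \sum_(s \in jump_times w `&` D) h s.

Definition predictable_rectangles {R : realType} : set (set (R * Omega R)) :=
  [set B | exists s t (A : set (Omega R)),
     [/\ 0 <= s, s <= t, natural_filtration s A & B = `]s, t] `*` A]].

(* Predictability only matters on ]0, +oo[ x Omega: integrals against dN and ds
   do not see the values at other times. *)
Definition predictable {R : realType} (C : R * Omega R -> R) : Prop :=
  measurable_fun
    (setT : set (g_sigma_algebraType (@predictable_rectangles R))) C.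

(* Bremaud's definition of the stochastic intensity of N with respect to its
   natural filtration:
     E[int_0^oo C_s dN_s] = E[int_0^oo C_s l(s) ds]
   for every nonnegative predictable process C. *)
Definition has_intensity {R : realType} (P : probability (Omega R) R)
    (l : R -> Omega R -> R) : Prop :=
  forall C : R * Omega R -> R, predictable C -> (forall z, 0 <= C z) ->
    ((\int[P]_w (\esum_(s in jump_times w) (C (s, w))%:E)) =
     (\int[P]_w (\int[lebesgue_measure]_(s in `]0%R, +oo[)
       (C (s, w) * l s w)%:E)))%E.

Definition hawkes_intensity {R : realType} (lam mu gamma : R -> R)
    (t : R) (w : Omega R) : R :=
  lam t + gamma (int_dN `]0, t[ (fun s => mu (t - s)) w).

Record hawkes_coefficients {R : realType} (lam mu gamma : R -> R) : Prop := {
  hawkes_lam_derivable : derivable_halfline lam;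
  hawkes_lam_bounded : bounded_derive_halfline lam;
  hawkes_lam_lower : exists2 lstar, 0 < lstar & forall t, 0 <= t -> lstar <= lam t;
  hawkes_mu_ge0 : forall t, 0 <= t -> 0 <= mu t;
  hawkes_mu_C1 : C1_halfline mu;
  hawkes_mu_bounded : bounded_derive_halfline mu;
  hawkes_mu_L1 : lebesgue_measure.-integrable halfline (EFin \o mu);
  hawkes_gamma_ge0 : forall x, 0 <= x -> 0 <= gamma x;
  hawkes_gamma_C1 : C1_halfline gamma;
  hawkes_gamma_bounded : bounded_derive_halfline gamma;
  hawkes_gamma0 : gamma 0 = 0;
  hawkes_stable :
    (ereal_sup [set `|derive_halfline gamma x|%:E | x in halfline] *
     (\int[lebesgue_measure]_(t in halfline) (mu t)%:E) < 1)%E }.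

Record sde_coefficients {R : realType} (f g : R -> R) : Prop := {
  sde_f_C1 : C1 f;
  sde_g_C1 : C1 g;
  sde_f_bounded : exists K : R, forall x, `|derive1 f x| <= K;
  sde_g_bounded : exists K : R, forall x, `|derive1 g x| <= K;
  sde_jump_neq0 : forall x, 1 + derive1 g x != 0;
  sde_jump_inv_bounded : exists K : R, forall x, `|(1 + derive1 g x)^-1| <= K }.

Definition cadlag_on {R : realType} (T : R) (x : R -> R) : Prop :=
  (forall t, 0 <= t < T -> x s @[s --> t^'+] --> x t) /\
  (forall t, 0 < t <= T -> cvg (x s @[s --> t^'-])).

(* X_t = x0 + int_0^t f(X_s) ds + int_]0,t] g(X_{s-}) dN_s for 0 <= t <= T,
   P-almost surely, with X adapted and cadlag. *)
Definition sde_solution {R : realType} (P : probability (Omega R) R) (T : R)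
    (f g : R -> R) (x0 : R) (X : R -> Omega R -> R) : Prop :=
  (forall t, 0 <= t <= T -> forall B : set R, measurable B ->
     natural_filtration t (X t @^-1` B)) /\
  {ae P, forall w,
     cadlag_on T (fun t => X t w) /\
     forall t, 0 <= t <= T ->
       X t w = x0 + (\int[lebesgue_measure]_(s in `[0, t]) f (X s w))%R
         + int_dN `]0, t] (fun s => g (lim (X u w @[u --> s^'-]))) w}.

Definition wronskian {R : realType} (f g : R -> R) (x : R) : R :=
  derive1 g x * f x - derive1 f x * g x.

(* The law of Y under P( . | E). *)
Definition cond_law {R : realType} (P : probability (Omega R) R)
    (E : set (Omega R)) (Y : Omega R -> R) (B : set R) : \bar R :=
  (P (Y @^-1` B `&` E) / P E)%E.

(* Main.v *)
(** Let [phi] be the flow of [f] and [h y = y + g y]. If [s] is the last jump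
    time before [T], then [X_T = phi (T - s) (h X_(s-))]. Set
    [Q_s = phi (T - s) (h X_s)]. Between two jumps [X] follows the flow, and
    [Q_t - Q_s] compares [phi (t - s) \o h] with [h \o phi (t - s)] at [X_s]; to
    first order in [t - s] the difference is [(1 + g') f - f \o h], which by
    Taylor's formula and the bound on the Wronskian never vanishes. Hence, on
    every path, a null set [B] is visited by [s |-> Q_(s-)] only for a null set of
    times. Since [s |-> Q_(s-)] is predictable, the compensator formula
    [E (sum_(jumps s) 1_(Q_(s-) \in B)) = E (int 1_(Q_(s-) \in B) l_s ds) = 0]
    yields [P (X_T \in B, N_T >= 1) = 0]. *)

Require Import Defs.
From HB Require Import structures.
From mathcomp Require Import all_boot all_order all_algebra.
From mathcomp Require Import all_classical all_reals all_analysis.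
From mathcomp Require Import measurable_realfun.
From mathcomp Require Import ring lra.

Set Implicit Arguments.
Unset Strict Implicit.
Unset Printing Implicit Defensive.

Import Order.TTheory GRing.Theory Num.Theory.
Import numFieldNormedType.Exports.

Local Open Scope ring_scope.
Local Open Scope classical_set_scope.

(** * Null sets *)

(** Two obstacles shape the proof. First, the separation of [Q_t] from [Q_s] is one-sided, local and
    not uniform: its rate and the length of the right neighbourhood depend on [s]. The times are
    therefore cut into countably many pieces on which [Q] expands all distances by a fixed factor,
    and an expanding map pulls null sets back to null sets by a covering argument. Second, the sum
    over the jump times and the sets of hitting times are never proved measurable, so null sets are
    handled through outer measure and through integral lemmas valid for arbitrary functions. The
    constant 1/2 is Taylor's: if [(1 + g') f = f \o h] at [x], then [f (x + g x) - f x - f' x * g x]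
    equals the Wronskian at [x], while it is at most half of [||f''|| * (g x)^2], which the strict
    inequality excludes. [Q_s] is built on [X_s] rather than on [X_(s-)] so that adaptedness is
    inherited directly; its left limit restores the state before the jump and is predictable. *)

Section integral_eq0.
Import HBNNSimple.

(** The integral of a nonnegative function is a supremum over the simple functions below it, and the
    indicator of [A] is one of them. This covers a non-measurable [f]; it will be the sum over the
    jump times. *)
Lemma measure_eq0_of_integral_eq0 d (T : measurableType d) (R : realType)
    (mu : {measure set T -> \bar R}) (f : T -> \bar R) (A : set T) :
  (forall x, 0 <= f x)%E -> (\int[mu]_x f x = 0)%E -> measurable A ->
  (forall x, A x -> (1 <= f x)%E) -> mu A = 0%E.
Proof.
move=> f0 If mA fA; apply/eqP; rewrite -measure_le0 -If ge0_integralTE//.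
apply: ereal_sup_ubound; exists (indic_nnsfun R mA); last first.
  by rewrite /= sintegral_indic.
move=> x; rewrite (_ : indic_nnsfun R mA x = \1_A x)// indicE.
have [xA|xA] := boolP (x \in A) => //.
by apply: fA; rewrite inE in xA.
Qed.

(** A simple function below the positive or the negative part of [f] vanishes off a null set, so its
    integral is zero; again [f] may fail to be measurable. *)
Lemma integral_eq0_negligible d (T : measurableType d) (R : realType)
    (mu : {measure set T -> \bar R}) (D N : set T) (f : T -> \bar R) :
  mu.-negligible N -> (forall x, D x -> ~ N x -> f x = 0%E) ->
  (\int[mu]_(x in D) f x = 0)%E.
Proof.
move=> [M [mM M0 NM]] fN.
suff H (g : T -> \bar R) : (forall x, 0 <= g x)%E ->
    (forall x, D x -> ~ M x -> g x = 0%E) -> (\int[mu]_(x in D) g x = 0)%E.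
  have fM x : D x -> ~ M x -> f x = 0%E by move=> Dx Mx; apply: fN => // /NM.
  rewrite integralE !H ?subee// => x Dx Mx.
    by rewrite funenegE fM// oppe0 maxxx.
  by rewrite funeposE fM// maxxx.
move=> g0 gM; rewrite integral_mkcond.
have gD0 x : (0 <= (g \_ D) x)%E by rewrite patchE; case: ifP.
rewrite ge0_integralTE//; apply/eqP; rewrite eq_le; apply/andP; split; last first.
  apply: ereal_sup_ubound; exists (cst_nnsfun T (0%:nng : {nonneg R})) => //=.
  exact: sintegral0.
apply: ge_ereal_sup => _ [h hg <-]; rewrite -integralT_nnsfun.
rewrite (_ : (\int[mu]_x (h x)%:E = 0)%E)//.
have := (ae_eq_integral_abs mu measurableT (f := EFin \o h)).
have -> : (\int[mu]_x `|(EFin \o h) x| = \int[mu]_x (h x)%:E)%E.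
  by apply: eq_integral => x _ /=; rewrite ger0_norm.
move=> ->; last by apply/measurable_EFinP.
exists M; split => // x; apply: contra_notP => Mx _ /=.
apply/eqP; rewrite eq_le lee_fin; apply/andP; split; last exact: fun_ge0.
rewrite -lee_fin; apply: le_trans (hg x) _.
by rewrite patchE; case: ifPn => // /[!inE] Dx; rewrite gM.
Qed.

End integral_eq0.

(** Two points of the preimage are at distance at most [r = (b - a) / c], so the preimage lies in
    the interval of radius [r] about any of its points; its length [2 r] explains the factor
    [2 / c]. *)
Lemma outer_measure_preimage_le (R : realType) (u : R -> R) (A : set R) (c a b : R) :
  0 < c -> a <= b ->
  (forall s t, A s -> A t -> c * `|s - t| <= `|u s - u t|) ->
  (((@wlength R idfun)^*)%mu (A `&` u @^-1` `]a, b]) <=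
     (2 / c)%:E * wlength idfun `]a, b])%E.
Proof.
move=> c0 ab uA; set S := A `&` _.
rewrite wlength_itv /= lte_fin.
have -> : ((if (a < b)%R then b%:E - a%:E else 0) = (b - a)%:E)%E.
  by move: ab; rewrite le_eqVlt => /predU1P[->|->//]; rewrite ltxx subrr.
have [[s [As us]]|S0] := pselect (S !=set0); last first.
  have -> : S = set0 by rewrite -subset0 => x Sx; apply: S0; exists x.
  by rewrite outer_measure0 -EFinM lee_fin mulr_ge0// ?subr_ge0// divr_ge0// ltW.
pose r := (b - a) / c.
have r0 : 0 <= r by rewrite divr_ge0 ?subr_ge0// ltW.
have SI : S `<=` `[s - r, s + r].
  move=> t [At ut]; rewrite /= in_itv/= -ler_distlC /r ler_pdivlMr// mulrC.
  rewrite (le_trans (uA _ _ As At))//.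
  move: us ut; rewrite /= !in_itv/= => /andP[? ?] /andP[? ?].
  by rewrite ler_norml; lra.
apply: (le_trans (le_outer_measure (@wlength R idfun)^*%mu _ _ SI)).
change (lebesgue_measure (`[(s - r)%R, (s + r)%R] : set R)
  <= (2 / c)%:E * (b - a)%:E)%E.
rewrite lebesgue_measure_itv/= lte_fin; case: ifP => _; last first.
  by rewrite -EFinM lee_fin mulr_ge0// ?subr_ge0// divr_ge0// ltW.
rewrite -EFinM -EFinB lee_fin /r; lra.
Qed.

(** A cover of [B] by intervals of total length below [e / (2 / c)] pulls back, interval by
    interval, to sets of total outer measure at most [e]. *)
Lemma negligible_preimage_expanding (R : realType) (u : R -> R) (A B : set R) (c : R) :
  0 < c -> (forall s t, A s -> A t -> c * `|s - t| <= `|u s - u t|) ->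
  lebesgue_measure.-negligible B ->
  lebesgue_measure.-negligible (A `&` u @^-1` B).
Proof.
move=> c0 uA /negligible_outer_measure B0; apply/negligible_outer_measure.
apply/eqP; rewrite eq_le outer_measure_ge0 andbT.
have c2 : (0 < 2 / c)%R by rewrite divr_gt0.
apply/lee_addgt0Pr => /= e e0; rewrite add0e.
have : (((@wlength R idfun)^*)%mu B < (e / (2 / c))%:E)%E.
  by rewrite B0 lte_fin divr_gt0.
move=> /ereal_inf_lt[_ [F [mF BF] <-] Fe].
have FE k : exists ab : R * R, ab.1 <= ab.2 /\ F k = `]ab.1, ab.2]%classic.
  have [[x y] _ /= <-] := mF k.
  have [xy|yx] := leP x y; first by exists (x, y).
  by exists (x, x); split => //; rewrite !set_itv_ge// bnd_simp -leNgt// ltW.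
have sub : A `&` u @^-1` B `<=` \bigcup_k (A `&` u @^-1` (F k)).
  by move=> x [Ax /BF[k _ ?]]; exists k.
apply: (le_trans (le_outer_measure (@wlength R idfun)^*%mu _ _ sub)).
apply: (le_trans (outer_measure_sigma_subadditive (@wlength R idfun)^*%mu _)).
apply: (@le_trans _ _ (\sum_(k <oo) (2 / c)%:E * wlength idfun (F k))%E).
  apply: lee_nneseries => // k _.
  have [[x y] /= [xy ->]] := FE k; exact: outer_measure_preimage_le.
rewrite nneseriesZl//.
have -> : (e%:E = (2 / c)%:E * (e / (2 / c))%:E)%E.
  by rewrite -EFinM mulrC divfK// gt_eqF.
by apply: lee_wpmul2l; [rewrite lee_fin ltW|exact: ltW].
Qed.

(* [A] is a countable union of sets on which [u] expands distances. *)
Lemma negligible_preimage_right_expanding (R : realType) (u : R -> R) (A B : set R) :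
  (forall s, A s -> exists2 c, 0 < c &
     \forall t \near s^'+, A t -> c * (t - s) <= `|u t - u s|) ->
  lebesgue_measure.-negligible B ->
  lebesgue_measure.-negligible (A `&` u @^-1` B).
Proof.
move=> uA B0.
(* The index [m] bounds from below both the expansion rate and the range on which it holds; [n]
   encodes a cell of length [m.+1%:R^-1]. Two points of one piece are thus within range of each
   other, and the estimate at the smaller one applies. *)
pose E m n := [set s | [/\ A s, forall t, A t -> s < t < s + m.+1%:R^-1 ->
  m.+1%:R^-1 * (t - s) <= `|u t - u s| & pickle (Num.floor (s * m.+1%:R)) = n]].
have sub : A `&` u @^-1` B `<=` \bigcup_m \bigcup_n (E m n `&` u @^-1` B).
  move=> s [As us]; have [c c0 [d /= d0 Hd]] := uA _ As.
  near \oo => m; exists m => //.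
  exists (pickle (Num.floor (s * m.+1%:R))) => //.
  split => //; split => // t At /andP[st tsm].
  apply: (@le_trans _ _ (c * (t - s))); last first.
    apply: Hd => //; rewrite /ball_/= distrC gtr0_norm ?subr_gt0// ltrBlDl.
    rewrite (lt_trans tsm)// ltrD2l.
    by near: m; exact: (near_infty_natSinv_lt (PosNum d0)).
  rewrite ler_pM2r ?subr_gt0// ltW//.
  by near: m; exact: (near_infty_natSinv_lt (PosNum c0)).
refine (@negligibleS _ _ _ (@lebesgue_measure R) _ _ sub _).
apply: negligible_bigcup => m; apply: negligible_bigcup => n.
apply: (@negligible_preimage_expanding _ _ _ _ m.+1%:R^-1) => // s t.
wlog st : s t / s <= t.
  move=> H Es Et; have [st|/ltW ts] := leP s t; first exact: H.
  by rewrite distrC [leRHS]distrC; apply: H.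
move: st; rewrite le_eqVlt => /predU1P[->|st] [As Es <-] [At _].
  by rewrite !subrr !normr0 mulr0.
move=> /(pcan_inj pickleK) fst.
rewrite distrC [leRHS]distrC gtr0_norm ?subr_gt0//; apply: Es => //.
rewrite st/= -ltrBlDl -[m.+1%:R^-1]mul1r ltr_pdivlMr//.
have := floor_itv (s * m.+1%:R); have := floor_itv (t * m.+1%:R).
rewrite fst !intrD => /andP[_ ?] /andP[? _]; rewrite mulrBl; lra.
Unshelve. all: by end_near. Qed.

(** * Differential inequalities *)

Lemma is_derive_continuous (R : realType) (f f' : R -> R) :
  (forall x : R, is_derive x 1 f (f' x)) -> continuous f.
Proof.
by move=> df x; apply/differentiable_continuous/derivable1_diffP; have [] := df x.
Qed.

Lemma ger0_derive_le (R : realType) (h h' : R -> R) (a b : R) : a <= b ->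
  {within `[a, b], continuous h} ->
  (forall t, a < t < b -> is_derive t 1 h (h' t)) ->
  (forall t, a < t < b -> 0 <= h' t) -> h a <= h b.
Proof.
rewrite le_eqVlt => /predU1P[->//|ab] ch dh h0.
have dh' x : x \in `]a, b[%R -> is_derive x 1 h (h' x) by rewrite in_itv; exact: dh.
have [c cab E] := MVT ab dh' ch; rewrite in_itv/= in cab.
by rewrite -subr_ge0 E mulr_ge0 ?subr_ge0 ?(ltW ab)// h0.
Qed.

(** Both [E - h] and [E + h] are nondecreasing. This takes the place of integral estimates in the
    Picard iteration and in Taylor's formula. *)
Lemma derive_dominated (R : realType) (h h' E E' : R -> R) (a b : R) : a <= b ->
  {within `[a, b], continuous h} -> {within `[a, b], continuous E} ->
  (forall t, a < t < b -> is_derive t 1 h (h' t)) ->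
  (forall t, a < t < b -> is_derive t 1 E (E' t)) ->
  (forall t, a < t < b -> `|h' t| <= E' t) -> `|h b - h a| <= E b - E a.
Proof.
move=> ab ch cE dh dE hE.
have H1 : (E \- h) a <= (E \- h) b.
  apply: (@ger0_derive_le _ _ (E' \- h')) => // [|t tab|t tab].
  - exact: within_continuousB.
  - exact: (is_deriveB (dE _ tab) (dh _ tab)).
  - by have := hE _ tab; rewrite ler_norml => /andP[_]; rewrite subr_ge0.
have H2 : (E \+ h) a <= (E \+ h) b.
  apply: (@ger0_derive_le _ _ (E' \+ h')) => // [|t tab|t tab].
  - exact: within_continuousD.
  - exact: (is_deriveD (dE _ tab) (dh _ tab)).
  - have := hE _ tab; rewrite ler_norml => /andP[+ _] /=.
    by rewrite -subr_ge0 opprK addrC.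
move: H1 H2 => /=; rewrite ler_norml; lra.
Qed.

(* [(y - z)^2 exp (- 2 K t)] decreases and [(y - z)^2 exp (2 K t)] increases. *)
Lemma gronwall_expR (R : realType) (f y z : R -> R) (K a b : R) : a <= b ->
  (forall u v, `|f u - f v| <= K * `|u - v|) ->
  {within `[a, b], continuous y} -> {within `[a, b], continuous z} ->
  (forall t, a < t < b -> is_derive t 1 y (f (y t))) ->
  (forall t, a < t < b -> is_derive t 1 z (f (z t))) ->
  `|y b - z b| <= expR (K * (b - a)) * `|y a - z a| /\
  `|y a - z a| <= expR (K * (b - a)) * `|y b - z b|.
Proof.
move=> ab fK cy cz dy dz.
(* The square is differentiable where the distance itself may not be, and satisfies
   [|D'| <= 2 K D]. *)
pose D t := (y t - z t) * (y t - z t).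
pose D' t := 2 * (y t - z t) * (f (y t) - f (z t)).
have D'D t : `|D' t| <= 2 * K * D t.
  rewrite /D' !normrM ger0_norm// -mulrA.
  rewrite [leRHS](_ : _ = 2 * (`|y t - z t| * (K * `|y t - z t|))).
    by rewrite ler_pM2l// ler_wpM2l.
  by rewrite /D -expr2 -real_normK ?num_real// expr2; ring.
have cexp c : {within `[a, b], continuous (fun t : R => expR (c * t))}.
  apply: continuous_subspaceT => x.
  apply: continuous_comp; last exact: continuous_expR.
  exact: mulrl_continuous.
have cD c : {within `[a, b], continuous (fun t => D t * expR (c * t))}.
  have cB := within_continuousB cy cz.
  move=> x; apply: continuousM; last exact: cexp.
  by apply: (continuousM (cB x) (cB x)).
have dD c t : a < t < b ->
   is_derive t 1 (fun t => D t * expR (c * t)) ((D' t + c * D t) * expR (c * t)).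
  move=> tab; have dB := is_deriveB (dy _ tab) (dz _ tab).
  have := is_deriveM (is_deriveM dB dB) (is_derive1_comp (is_derive_expR (c * t))
    (is_deriveZ (f := @id R) c (is_derive_id t 1))).
  move/is_derive_eq; apply; rewrite /D' /D /GRing.scale/= !fctE/=.
  ring.
have E0 : expR (K * (b - a)) ^+ 2 = expR (2 * K * b) * expR (- (2 * K) * a).
  by rewrite expr2 -!expRD; congr expR; ring.
have EK : expR (- (2 * K) * b) * expR (2 * K * b) = 1.
  by rewrite -expRD mulNr addNr expR0.
have EKa : expR (- (2 * K) * a) * expR (2 * K * a) = 1.
  by rewrite -expRD mulNr addNr expR0.
have Hsq (u v : R) : u * u <= expR (K * (b - a)) ^+ 2 * (v * v) ->
    `|u| <= expR (K * (b - a)) * `|v|.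
  move=> H; rewrite -ler_sqr ?nnegrE ?mulr_ge0 ?expR_ge0//.
  by rewrite exprMn !real_normK ?num_real// expr2 (expr2 v).
split; apply: Hsq.
  have : - (D a * expR (- (2 * K) * a)) <= - (D b * expR (- (2 * K) * b)).
    apply: (@ger0_derive_le _ (fun t => - (D t * expR (- (2 * K) * t)))
       (fun t => - ((D' t + - (2 * K) * D t) * expR (- (2 * K) * t)))) => //.
    - by move=> x; apply: cvgN; exact: cD.
    - by move=> t tab; apply: is_deriveN; exact: dD.
    - move=> t tab; rewrite oppr_ge0 pmulr_lle0 ?expR_gt0//.
      by have := D'D t; rewrite ler_norml; lra.
  rewrite lerN2 -(ler_pM2r (expR_gt0 (2 * K * b))) -[X in X <= _]mulrA EK mulr1.
  by rewrite E0 /D; lra.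
have : D a * expR (2 * K * a) <= D b * expR (2 * K * b).
  apply: (@ger0_derive_le _ (fun t => D t * expR (2 * K * t))
     (fun t => (D' t + 2 * K * D t) * expR (2 * K * t))) => //.
  move=> t tab; rewrite pmulr_lge0 ?expR_gt0//.
    by have := D'D t; rewrite ler_norml; lra.
rewrite -(ler_pM2r (expR_gt0 (- (2 * K) * a))).
rewrite -[X in X <= _]mulrA (mulrC (expR (2 * K * a))) EKa mulr1.
by rewrite E0 /D; lra.
Qed.

Lemma lipschitz_continuous (R : realType) (f : R -> R) (K : R) :
  (forall u v, `|f u - f v| <= K * `|u - v|) -> continuous f.
Proof.
move=> fK x; apply/cvgrPdist_lt => e e0.
have K1 : 0 < `|K| + 1 by rewrite ltr_wpDl.
near=> t; apply: (@le_lt_trans _ _ ((`|K| + 1) * `|x - t|)).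
  apply: le_trans (fK _ _) _; rewrite ler_wpM2r// (le_trans (ler_norm _))// lerDl//.
rewrite -ltr_pdivlMl// mulrC.
near: t; apply: cvgr_dist_lt; last by rewrite divr_gt0.
exact: cvg_id.
Unshelve. all: by end_near. Qed.

(** * Picard iteration *)

(** At 0 only continuity is claimed: the domain of integration is empty for negative [t], so the
    primitive may have a corner there. *)
Lemma continuous_primitive (R : realType) (h : R -> R) :
  continuous h ->
  let F t := (\int[lebesgue_measure]_(s in `[0, t]) h s)%R in
  [/\ continuous F, forall t, t <= 0 -> F t = 0 &
    forall t : R, 0 < t -> is_derive t 1 F (h t)].
Proof.
move=> ch F.
have ih t : lebesgue_measure.-integrable `[0, t] (EFin \o h).
  apply: continuous_compact_integrable; first exact: segment_compact.
  exact: continuous_subspaceT.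
have F0 t : t <= 0 -> F t = 0.
  rewrite /F le_eqVlt => /predU1P[->|t0]; first by rewrite set_itv1 Rintegral_set1.
  by rewrite set_itv_ge ?Rintegral_set0// bnd_simp -ltNge.
have dF (t : R) : 0 < t -> is_derive t 1 F (h t).
  move=> t0; have tt1 : t < t + 1 by rewrite ltrDl.
  have [d1 d2] := continuous_FTC1_closed tt1 (ih _) t0 (ch t).
  by apply: DeriveDef; [exact: d1|rewrite -derive1E; exact: d2].
have cF0 : F x @[x --> 0] --> F 0.
  by rewrite (F0 0)//; exact: parameterized_integral_cvg_left ltr01 (ih 1).
split; [|exact: F0|exact: dF] => t; have [t0|t0|->//] := ltgtP t 0.
  apply: (@near_cst_continuous _ _ 0); near=> y; apply: F0; apply: ltW.
  by near: y; exact: lt_nbhsl.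
by apply/differentiable_continuous/derivable1_diffP; have [] := dF _ t0.
Unshelve. all: by end_near. Qed.

(** The intervals of radius [2 * C * 2^-1 ^+ n] about [u n] are nested; the supremum of their left
    ends lies in all of them, which yields the limit together with its rate. *)
Lemma geometric_increments_limit (R : realType) (u : nat -> R) (C : R) :
  (forall n, `|u n.+1 - u n| <= C * 2^-1 ^+ n) ->
  exists l, forall n, `|l - u n| <= 2 * C * 2^-1 ^+ n.
Proof.
move=> uC; pose a n := u n - 2 * C * 2^-1 ^+ n; pose b n := u n + 2 * C * 2^-1 ^+ n.
have C0 : 0 <= C by have := le_trans (normr_ge0 _) (uC 0%N); rewrite expr0 mulr1.
have e0 n : 0 <= 2 * C * 2^-1 ^+ n :> R by rewrite !mulr_ge0 ?exprn_ge0.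
have nda : nondecreasing_seq a.
  apply/nondecreasing_seqP => n; have := uC n; rewrite /a exprS ler_norml; lra.
have nib : nonincreasing_seq b.
  apply/nonincreasing_seqP => n; have := uC n; rewrite /b exprS ler_norml; lra.
have ab n m : a n <= b m.
  apply: le_trans (nda _ _ (leq_maxl n m)) _.
  apply: le_trans (nib _ _ (leq_maxr n m)).
  by rewrite /a /b; have := e0 (maxn n m); lra.
have ubA m : ubound (range a) (b m) by move=> _ [n _ <-].
exists (sup (range a)) => n.
have : a n <= sup (range a).
  by apply: ub_le_sup; [exists (b 0%N)|exists n].
have : sup (range a) <= b n by apply: ge_sup => //; exists (a 0%N); exists 0%N.
by rewrite /a /b ler_norml; lra.
Qed.

Lemma geometric_small (R : realType) (C e : R) : 0 < e ->
  exists n, C * 2^-1 ^+ n < e.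
Proof.
move=> e0.
have : (C * 2^-1 ^+ n) @[n --> \oo] --> C * 0.
  by apply: cvgMr; apply: cvg_expr; rewrite ger0_norm// invf_lt1// ltr1n.
by rewrite mulr0 => /cvgr_lt /(_ _ e0)[n _ nP]; exists n; exact: (nP n (leqnn n)).
Qed.

Lemma le_geometric_eq0 (R : realType) (a C : R) :
  (forall n, `|a| <= C * 2^-1 ^+ n) -> a = 0.
Proof.
move=> aC; apply/eqP; rewrite -normr_eq0; apply/negPn/negP => a0.
have [|n] := @geometric_small _ C `|a|; first by rewrite lt_def a0/=.
by rewrite ltNge aC.
Qed.

Section picard.
Variables (R : realType) (f : R -> R) (K : R).
Hypothesis K0 : 0 < K.
Hypothesis fK : forall u v, `|f u - f v| <= K * `|u - v|.

Lemma lipschitz_comp_continuous (y : R -> R) : continuous y -> continuous (f \o y).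
Proof.
move=> cy x; apply: continuous_comp; [exact: cy|exact: lipschitz_continuous fK _].
Qed.

Fixpoint picard_iter (z : R) n : R -> R :=
  if n is n.+1 then
    fun t => z + (\int[lebesgue_measure]_(s in `[0, t]) f (picard_iter z n s))%R
  else fun=> z.

(** Chosen so that the derivative of [weight (M z)] is [|f z| * expR (2 * K * t)], which dominates
    the first Picard increment. *)
Let M z := `|f z| / (2 * K).

(* Relative to this weight, each iteration halves the distances. *)
Let weight (C t : R) := C * expR (2 * K * t).

Let weight_derive (C t : R) : is_derive t 1 (weight C) (2 * K * weight C t).
Proof.
rewrite /weight.
have := is_deriveZ C (is_derive1_comp (is_derive_expR (2 * K * t))
  (is_deriveZ (f := @id R) (2 * K) (is_derive_id t 1))).
by move/is_derive_eq; apply; rewrite /GRing.scale/=; ring.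
Qed.

Let weight_continuous C : continuous (weight C) :=
  is_derive_continuous (weight_derive C).

Let weight_ge0 C t : 0 <= C -> 0 <= weight C t.
Proof. by move=> C0; rewrite mulr_ge0 ?expR_ge0. Qed.

Lemma picard_iter_continuous z n : continuous (picard_iter z n).
Proof.
elim: n => [|n IH]; first by move=> x; exact: cvg_cst.
have [cF _ _] := continuous_primitive (lipschitz_comp_continuous IH).
by move=> x /=; apply: cvgD; [exact: cvg_cst|exact: cF].
Qed.

Lemma picard_iter_derive z n (t : R) : 0 < t ->
  is_derive t 1 (picard_iter z n.+1) (f (picard_iter z n t)).
Proof.
move=> t0; have [_ _ /(_ _ t0) dF] :=
  continuous_primitive (lipschitz_comp_continuous (@picard_iter_continuous z n)).
have := is_deriveD (is_derive_cst z t 1) dF.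
by move/is_derive_eq; apply; rewrite add0r.
Qed.

Lemma picard_iter_le0 z n (t : R) : t <= 0 -> picard_iter z n t = z.
Proof.
case: n => // n t0; have [_ /(_ _ t0) F0 _] :=
  continuous_primitive (lipschitz_comp_continuous (@picard_iter_continuous z n)).
by rewrite /= F0 addr0.
Qed.

(** The weight is multiplied by [2 * K] when differentiated, whereas the Lipschitz bound costs only
    [K]: each induction step gains a factor 1/2. *)
Lemma picard_iter_increment z n (t : R) : 0 <= t ->
  `|picard_iter z n.+1 t - picard_iter z n t| <= weight (M z) t * 2^-1 ^+ n.
Proof.
have M0 : 0 <= M z by rewrite divr_ge0// mulr_ge0// ltW.
have e0 m : 0 <= 2^-1 ^+ m :> R by rewrite exprn_ge0.
have cs (s : R) (h : R -> R) : continuous h -> {within `[0, s], continuous h}.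
  exact: continuous_subspaceT.
elim: n t => [|n IH] t t0.
  have := @derive_dominated R (picard_iter z 1) (fun=> f z)
    (weight (M z)) (fun t => 2 * K * weight (M z) t) 0 t t0.
  rewrite (picard_iter_le0 _ _ (lexx 0)) expr0 mulr1 => H.
  apply: le_trans (H _ _ _ _ _) _.
  - by apply: cs; exact: picard_iter_continuous.
  - by apply: cs; exact: weight_continuous.
  - by move=> s /andP[s0 _]; exact: (@picard_iter_derive z 0).
  - by move=> s _; exact: weight_derive.
  - move=> s /andP[s0 _]; rewrite /weight /M.
    have -> : 2 * K * (`|f z| / (2 * K) * expR (2 * K * s)) =
        `|f z| * expR (2 * K * s).
      by field; rewrite gt_eqF.
    by rewrite ler_peMr// -expR0 ler_expR !mulr_ge0// ltW.
  - by rewrite gerBl; exact: weight_ge0.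
have := @derive_dominated R (picard_iter z n.+2 \- picard_iter z n.+1)
   (fun t => f (picard_iter z n.+1 t) - f (picard_iter z n t))
   (weight (M z * 2^-1 ^+ n.+1))
   (fun t => 2 * K * weight (M z * 2^-1 ^+ n.+1) t) 0 t t0.
have E m s : weight (M z * 2^-1 ^+ m) s = weight (M z) s * 2^-1 ^+ m.
  by rewrite /weight mulrAC.
have -> : (picard_iter z n.+2 \- picard_iter z n.+1) 0 = 0.
  rewrite -[LHS]/(picard_iter z n.+2 0 - picard_iter z n.+1 0).
  by rewrite !(picard_iter_le0 _ _ (lexx 0)) subrr.
rewrite subr0 => H.
apply: le_trans (H _ _ _ _ _) _.
- by apply: cs => x; apply: cvgB; exact: picard_iter_continuous.
- by apply: cs; exact: weight_continuous.
- move=> s /andP[s0 _].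
  exact: (is_deriveB (picard_iter_derive _ n.+1 s0) (picard_iter_derive _ n s0)).
- by move=> s _; exact: weight_derive.
- move=> s /andP[s0 st]; apply: le_trans (fK _ _) _.
  have : `|picard_iter z n.+1 s - picard_iter z n s| <= weight (M z) s * 2^-1 ^+ n.
    by apply: IH; exact: ltW.
  move/(ler_wpM2l (ltW K0))/le_trans; apply.
  rewrite E exprS; lra.
- rewrite -E gerBl; apply: weight_ge0; exact: mulr_ge0.
Qed.

Lemma ode_solution z : exists y : R -> R, [/\ continuous y,
  forall t, t <= 0 -> y t = z & forall t : R, 0 < t -> is_derive t 1 y (f (y t))].
Proof.
have M0 : 0 <= M z by rewrite divr_ge0// mulr_ge0// ltW.
have e0 m : 0 <= 2^-1 ^+ m :> R by rewrite exprn_ge0.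
have /choice[y yP] : forall t : R, exists l, forall n, 0 <= t ->
    `|l - picard_iter z n t| <= 2 * weight (M z) t * 2^-1 ^+ n.
  move=> t; have [t0|t0] := leP 0 t; last by exists 0 => n.
  have [l lP] := geometric_increments_limit (fun n => picard_iter_increment z n t0).
  by exists l.
(* The estimates defining [y] hold for nonnegative times only, so its value at 0 is extended to the
   left. *)
pose x t := y (Num.max 0 t).
have xle0 t : t <= 0 -> x t = z.
  move=> t0; rewrite /x (max_idPl t0); apply/eqP; rewrite -subr_eq0; apply/eqP.
  apply: (@le_geometric_eq0 _ _ (2 * weight (M z) 0)) => n.
  by rewrite -[z in `|_ - z|](@picard_iter_le0 z n 0)//; exact: yP.
have xp t n : 0 <= t -> `|x t - picard_iter z n t| <= 2 * weight (M z) t * 2^-1 ^+ n.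
  by move=> t0; rewrite /x (max_idPr t0); exact: yP.
have xpb b t n : t <= b -> `|x t - picard_iter z n t| <= 2 * weight (M z) b * 2^-1 ^+ n.
  move=> tb; have [t0|t0] := leP t 0.
    rewrite xle0// picard_iter_le0// subrr normr0 mulr_ge0// mulr_ge0//.
    exact: weight_ge0.
  apply: le_trans (xp _ _ (ltW t0)) _.
  rewrite ler_wpM2r// ler_wpM2l// /weight ler_wpM2l// ler_expR ler_wpM2l//.
  by rewrite mulr_ge0// ltW.
have cx : continuous x.
  move=> t; apply/cvgrPdist_lt => e e1.
  have [n nP] := geometric_small (2 * weight (M z) (t + 1)) (divr_gt0 e1 (ltr0Sn _ 2)).
  near=> s.
  have st : s <= t + 1.
    by apply: ltW; near: s; apply: lt_nbhsl; rewrite ltrDl.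
  have tt1 : t <= t + 1 by rewrite lerDl.
  have H1 := le_lt_trans (xpb _ _ n st) nP.
  have H2 := le_lt_trans (xpb _ _ n tt1) nP.
  have H3 : `|picard_iter z n t - picard_iter z n s| < e / 3.
    near: s; apply: cvgr_dist_lt; last by rewrite divr_gt0.
    exact: picard_iter_continuous.
  by move: H1 H2 H3; rewrite !ltr_norml => /andP[? ?] /andP[? ?] /andP[? ?]; lra.
have [cF F0 dF] := continuous_primitive (lipschitz_comp_continuous cx).
pose F t := (\int[lebesgue_measure]_(s in `[0, t]) (f \o x) s)%R.
(* Both sides are within [weight (M z) t * 2^-1 ^+ n] of the iterate of rank [n.+1], for every
   [n]. *)
have xE t : x t = z + F t.
  have [t0|/ltW t0] := leP t 0; first by rewrite xle0// /F F0// addr0.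
  apply/eqP; rewrite -subr_eq0; apply/eqP.
  apply: (@le_geometric_eq0 _ _ (2 * weight (M z) t)) => n.
  have := @derive_dominated R (picard_iter z n.+1 \- F)
    (fun t => f (picard_iter z n t) - f (x t))
    (weight (M z * 2^-1 ^+ n)) (fun t => 2 * K * weight (M z * 2^-1 ^+ n) t) 0 t t0.
  have -> : (picard_iter z n.+1 \- F) 0 = z.
    by rewrite -[LHS]/(picard_iter z n.+1 0 - F 0) picard_iter_le0// /F F0// subr0.
  have cs (h : R -> R) : continuous h -> {within `[0, t], continuous h}.
    exact: continuous_subspaceT.
  have E m s : weight (M z * 2^-1 ^+ m) s = weight (M z) s * 2^-1 ^+ m.
    by rewrite /weight mulrAC.
  move=> H; have {H} : `|(picard_iter z n.+1 \- F) t - z| <= weight (M z) t * 2^-1 ^+ n.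
    apply: le_trans (H _ _ _ _ _) _.
    - by apply: cs => u; apply: cvgB; [exact: picard_iter_continuous|exact: cF].
    - by apply: cs; exact: weight_continuous.
    - move=> s /andP[s0 _].
      exact: (is_deriveB (picard_iter_derive _ n s0) (dF _ s0)).
    - by move=> s _; exact: weight_derive.
    - move=> s /andP[s0 st]; apply: le_trans (fK _ _) _.
      rewrite E distrC; have /(ler_wpM2l (ltW K0)) := xp s n (ltW s0); lra.
    - rewrite -E gerBl; apply: weight_ge0; exact: mulr_ge0.
  rewrite -[(_ \- _) t]/(picard_iter z n.+1 t - F t).
  have := xp t n.+1 t0; rewrite exprS !ler_norml => /andP[? ?] /andP[? ?]; lra.
exists x; split => // t t0.
have xF : x = cst z + F by apply/funext => s; rewrite xE.
rewrite [X in is_derive _ _ X _]xF.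
have H := is_deriveD (is_derive_cst z t 1) (dF _ t0).
by apply: (is_derive_eq H); rewrite add0r.
Unshelve. all: by end_near. Qed.

End picard.

(** * Flows *)

(* Only nonnegative times matter; extending by the initial value to negative
   times makes continuity hold on the whole line. *)
Definition is_flow (R : realType) (f : R -> R) (phi : R -> R -> R) :=
  forall z, [/\ continuous (phi^~ z), forall t, t <= 0 -> phi t z = z &
    forall t : R, 0 < t -> is_derive t 1 (phi^~ z) (f (phi t z))].

Lemma flow_exists (R : realType) (f : R -> R) (K : R) : 0 < K ->
  (forall u v, `|f u - f v| <= K * `|u - v|) -> exists phi, is_flow f phi.
Proof.
move=> K0 fK; have /choice[y yP] := ode_solution K0 fK.
by exists (fun t z => y z t) => z; exact: yP.
Qed.

Section flow.
Variables (R : realType) (f : R -> R) (K : R) (phi : R -> R -> R).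
Hypothesis fK : forall u v, `|f u - f v| <= K * `|u - v|.
Hypothesis phiP : is_flow f phi.

Lemma flow0 z : phi 0 z = z.
Proof. by have [_ + _] := phiP z; apply. Qed.

Lemma flow_continuous z : continuous (phi^~ z).
Proof. by have [] := phiP z. Qed.

Lemma flow_derive z (t : R) : 0 < t -> is_derive t 1 (phi^~ z) (f (phi t z)).
Proof. by have [_ _] := phiP z; exact. Qed.

(** Gronwall's inequality in both directions of time. The second bound, a quantitative injectivity,
    later transports a separation at time [t] to the final time [T]. *)
Lemma flow_lipschitz t u v : 0 <= t ->
  `|phi t u - phi t v| <= expR (K * t) * `|u - v| /\
  `|u - v| <= expR (K * t) * `|phi t u - phi t v|.
Proof.
move=> t0.
have := @gronwall_expR R f (phi^~ u) (phi^~ v) K 0 t t0 fK.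
rewrite subr0 !flow0; apply.
- by apply: continuous_subspaceT; exact: flow_continuous.
- by apply: continuous_subspaceT; exact: flow_continuous.
- by move=> s /andP[s0 _]; exact: flow_derive.
- by move=> s /andP[s0 _]; exact: flow_derive.
Qed.

Lemma flow_unique (y : R -> R) (a b : R) : a <= b ->
  {within `[a, b], continuous y} ->
  (forall t, a < t < b -> is_derive t 1 y (f (y t))) ->
  y b = phi (b - a) (y a).
Proof.
move=> ab cy dy.
pose z t := phi (t - a) (y a).
have cz : continuous z.
  move=> t; apply: (@continuous_comp _ _ _ (fun t => t - a) (phi^~ (y a))).
    by apply: cvgB; [exact: cvg_id|exact: cvg_cst].
  exact: flow_continuous.
have dz (t : R) : a < t -> is_derive t 1 z (f (z t)).
  move=> ta; have ta0 : 0 < shift (- a) t by rewrite /= subr_gt0.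
  have H := is_derive1_comp (flow_derive (y a) ta0) (is_derive_shift t 1 (- a)).
  by apply: (is_derive_eq H); rewrite mulr1.
have [+ _] := @gronwall_expR R f y z K a b ab fK cy (continuous_subspaceT cz) dy
  (fun t tab => dz t (andP tab).1).
rewrite /z subrr flow0 subrr normr0 mulr0 normr_le0 subr_eq0; exact: eqP.
Qed.

Lemma flowD s t z : 0 <= s -> 0 <= t -> phi (s + t) z = phi t (phi s z).
Proof.
move=> s0 t0; have := @flow_unique (phi^~ z) s (s + t).
rewrite lerDl t0 (addrC s t) addrK; apply => //.
  by apply: continuous_subspaceT; exact: flow_continuous.
by move=> r /andP[sr _]; apply: flow_derive; exact: le_lt_trans sr.
Qed.

(** Joint continuity: the Lipschitz constant in the starting point is uniform over bounded times,
    which reduces the claim to continuity in time from the fixed point [a0]. *)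
Lemma flow_cvg (T : Type) (F : set_system T) (FF : ProperFilter F) (tau a : T -> R) t0 a0 :
  (\forall i \near F, 0 <= tau i) -> tau i @[i --> F] --> t0 -> a i @[i --> F] --> a0 ->
  phi (tau i) (a i) @[i --> F] --> phi t0 a0.
Proof.
move=> tau0 ctau ca.
have K0 : 0 <= K.
  by have := fK 1 0; rewrite subr0 normr1 mulr1; apply: le_trans.
have cphi : phi (tau i) a0 @[i --> F] --> phi t0 a0.
  exact: (cvg_comp _ (phi^~ a0) ctau (@flow_continuous a0 t0)).
have : (fun i => expR (K * (t0 + 1)) * `|a i - a0|) @ F --> (0 : R).
  rewrite -[X in _ --> X](mulr0 (expR (K * (t0 + 1)))); apply: cvgMr.
  rewrite -[X in _ --> X](normr0 R); apply: cvg_norm; rewrite -(subrr a0).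
  by apply: cvgB => //; exact: cvg_cst.
move=> c0; have cd : phi (tau i) (a i) - phi (tau i) a0 @[i --> F] --> (0 : R).
  apply/cvgr0Pnorm_le => e e0; near=> i.
  apply: (@le_trans _ _ (expR (K * (t0 + 1)) * `|a i - a0|)).
    have [|+ _] := @flow_lipschitz (tau i) (a i) a0; first by near: i.
    move/le_trans; apply; rewrite ler_wpM2r// ler_expR ler_wpM2l//.
    by near: i; apply: cvgr_le ctau _ _; rewrite ltrDl.
  by near: i; apply: cvgr_le c0 _ _.
have -> : (fun i => phi (tau i) (a i)) =
    (fun i => (phi (tau i) (a i) - phi (tau i) a0) + phi (tau i) a0).
  by apply/funext => i; rewrite subrK.
rewrite -[phi t0 a0]add0r; exact: cvgD.
Unshelve. all: by end_near. Qed.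

End flow.

(** The difference vanishes at time 0 and its derivative [p] tends to [f (h z) - h' z * f z], which
    is nonzero. As the flow is differentiated at positive times only, the mean value theorem is
    applied on a short interval where [p] keeps half of its initial size. *)
Lemma flow_commutator_expands (R : realType) (f h h' : R -> R) (phi : R -> R -> R) z :
  is_flow f phi -> continuous f -> continuous h' ->
  (forall x : R, is_derive x 1 h (h' x)) ->
  h' z * f z != f (h z) ->
  exists2 c, 0 < c & \forall d \near 0^'+, c * d <= `|phi d (h z) - h (phi d z)|.
Proof.
move=> phiP cf ch' dh q0.
have ch := is_derive_continuous dh.
pose p t := f (phi t (h z)) - h' (phi t z) * f (phi t z).
have cp : continuous p.
  have cc (g : R -> R) u : continuous g -> continuous (fun t => g (phi t u)).
    move=> cg t; apply: (@continuous_comp _ _ _ (phi^~ u) g); last exact: cg.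
    exact: flow_continuous phiP _ _.
  by move=> t; apply: cvgB; [exact: cc|apply: cvgM; exact: cc].
have p0 : p 0 != 0 by rewrite /p !(flow0 phiP) subr_eq0 eq_sym.
exists (`|p 0| / 2); first by rewrite divr_gt0// normr_gt0.
have : \forall t \near 0, `|p 0| / 2 < `|p t|.
  have : (fun t => `|p t|) @ 0 --> `|p 0| by apply: cvg_norm; exact: cp.
  by move=> /cvgr_gt; apply; rewrite ltr_pdivrMr// ltr_pMr ?normr_gt0// ltr1n.
move=> [e /= e0 pe]; exists e => //= d; rewrite /ball_/= => de d0.
pose v t := phi t (h z) - h (phi t z).
have dv (t : R) : t \in `]0, d[%R -> is_derive t 1 v (p t).
  rewrite in_itv/= => /andP[t0 _].
  have dphi u := flow_derive phiP u t0.
  exact: (is_deriveB (dphi _) (is_derive1_comp (dh _) (dphi _))).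
have cv : continuous v.
  move=> t; apply: cvgB; first exact: flow_continuous phiP _ _.
  apply: (@continuous_comp _ _ _ (phi^~ z) h); last exact: ch.
  exact: flow_continuous phiP _ _.
have [c cd] := MVT d0 dv (continuous_subspaceT cv).
rewrite in_itv/= in cd; case/andP : cd => c0 cd.
rewrite {2}/v !(flow0 phiP) subrr !subr0 /v => ->.
rewrite normrM (gtr0_norm d0) ler_pM2r// ltW//; apply: pe.
rewrite /ball_/= sub0r normrN gtr0_norm// (lt_trans cd)//.
by move: de; rewrite sub0r normrN gtr0_norm.
Qed.

(** * The Wronskian condition *)

Lemma derivable_is_derive1 (R : realType) (f : R -> R) :
  (forall x, derivable f x 1) -> forall x : R, is_derive x 1 f (derive1 f x).
Proof. by move=> df x; rewrite derive1E; exact: derivableP. Qed.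

(** Parametrizing a displacement as [t * a] with [t] nonnegative handles both signs of [a] at
    once. *)
Lemma is_derive_line (R : realType) (f f' : R -> R) (y a t : R) :
  (forall x : R, is_derive x 1 f (f' x)) ->
  is_derive t 1 (fun t => f (y + t * a)) (a * f' (y + t * a)).
Proof.
move=> df.
have H1 := is_deriveD (is_derive_cst y t 1)
  (is_deriveZ (f := @id R) a (is_derive_id t 1)).
have -> : (fun t => f (y + t * a)) = f \o (cst y + (a \*: id)).
  by apply/funext => s; rewrite /= /GRing.add/= /GRing.scale/= mulrC.
apply: (is_derive_eq (is_derive1_comp (df ((cst y + (a \*: id)) t)) H1)).
rewrite add0r mulrC; congr (_ * f' (_ + _)); rewrite /GRing.scale/= ?mulr1//.
exact: mulrC.
Qed.

Lemma line_continuous (R : realType) (f f' : R -> R) (y a : R) :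
  (forall x : R, is_derive x 1 f (f' x)) -> continuous (fun t : R => f (y + t * a)).
Proof.
move=> df; apply: (is_derive_continuous (f' := fun t => a * f' (y + t * a))) => s.
exact: is_derive_line.
Qed.

Lemma lipschitz_of_derive (R : realType) (f f' : R -> R) (K y a : R) :
  (forall x : R, is_derive x 1 f (f' x)) -> (forall x, `|f' x| <= K) ->
  forall t, 0 <= t -> `|f (y + t * a) - f y| <= K * `|a| * t.
Proof.
move=> df fK t t0.
have := @derive_dominated R (fun t => f (y + t * a)) (fun t => a * f' (y + t * a))
  ((K * `|a|) \*: id) (fun=> K * `|a|) 0 t t0.
rewrite mul0r addr0 /= /GRing.scale/= mulr0 subr0; apply.
- by apply: continuous_subspaceT; exact: line_continuous df.
- apply: continuous_subspaceT => s; apply: cvgMr; exact: cvg_id.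
- by move=> s _; exact: is_derive_line.
- move=> s _; have := is_deriveZ (f := @id R) (K * `|a|) (is_derive_id s 1).
  by move/is_derive_eq; apply; rewrite /GRing.scale/= mulr1.
- by move=> s _; rewrite normrM mulrC ler_wpM2r.
Qed.

Lemma lipschitz_of_derive1 (R : realType) (f : R -> R) (K : R) :
  C1 f -> (forall x, `|derive1 f x| <= K) -> forall u v, `|f u - f v| <= K * `|u - v|.
Proof.
move=> [df _] fK u v.
have := lipschitz_of_derive v (u - v) (derivable_is_derive1 df) fK ler01.
by rewrite mul1r mulr1 subrKC.
Qed.

(** Along the segment the remainder has derivative [a * (f' (y + t * a) - f' y)], bounded by
    [M * a ^+ 2 * t], the derivative of [M / 2 * a ^+ 2 * t ^+ 2]; compare at [t = 1]. *)
Lemma taylor2_le (R : realType) (f : R -> R) (M y a : R) : C2 f ->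
  (forall x, `|derive1 (derive1 f) x| <= M) ->
  `|f (y + a) - f y - derive1 f y * a| <= M / 2 * a ^+ 2.
Proof.
move=> [[df _] [ddf _]] fM.
have d1 := derivable_is_derive1 df; have d2 := derivable_is_derive1 ddf.
pose r t := f (y + t * a) - (t * a) * derive1 f y.
have := @derive_dominated R r (fun t => a * (derive1 f (y + t * a) - derive1 f y))
  (fun t => M / 2 * a ^+ 2 * (t * t)) (fun t => M * a ^+ 2 * t) 0 1 ler01.
rewrite /r !mul0r !addr0 !mul1r !mulr0 !subr0 !mulr1 (mulrC a) => H.
rewrite addrAC; apply: H.
- apply: continuous_subspaceT => t; apply: cvgB.
    exact: line_continuous d1 t.
  by apply: cvgMl; apply: cvgMl; exact: cvg_id.
- apply: continuous_subspaceT => t; apply: cvgMr; apply: cvgM; exact: cvg_id.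
- move=> t _; have H1 := is_deriveZ (f := @id R) (a * derive1 f y) (is_derive_id t 1).
  have -> : (fun t => f (y + t * a) - t * a * derive1 f y) =
    (fun t => f (y + t * a)) - ((a * derive1 f y) \*: id).
    apply/funext => s; transitivity (f (y + s * a) - (a * derive1 f y) * s) => //.
    by ring.
  apply: (is_derive_eq (is_deriveB (is_derive_line y a t d1) H1)).
  by rewrite /GRing.scale/=; ring.
- move=> t _.
  have H1 := is_deriveZ (M / 2 * a ^+ 2)
    (is_deriveM (is_derive_id t 1) (is_derive_id t 1)).
  apply: (is_derive_eq H1); rewrite /GRing.scale/=; lra.
- move=> t /andP[t0 _]; rewrite normrM.
  have := lipschitz_of_derive y a d2 fM (ltW t0).
  move/(ler_wpM2l (normr_ge0 a))/le_trans; apply.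
  rewrite -[a ^+ 2]real_normK ?num_real// expr2; lra.
Qed.

Lemma sup_norm_ub (R : realType) (h : R -> R) x : (`|h x|%:E <= sup_norm h)%E.
Proof. by apply: ereal_sup_ubound; exists x. Qed.

(* The jump map [id + g] does not conjugate the flow of [f] to itself to first
   order: this is where the lower bound on the Wronskian is used. *)
Lemma wronskian_jump_neq (R : realType) (f g : R -> R) : C2 f ->
  (forall x : R,
      ((2^-1)%:E * sup_norm (derive1 (derive1 f)) * (sup_norm g) ^+ 2
         < `|wronskian f g x|%:E)%E) ->
  forall x, (1 + derive1 g x) * f x != f (x + g x).
Proof.
move=> f2 W x; apply/negP => /eqP E.
have Wr M : (forall y, `|derive1 (derive1 f) y| <= M) ->
    `|wronskian f g x| <= M / 2 * g x ^+ 2.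
  move=> fM; have := taylor2_le x (g x) f2 fM; rewrite -E /wronskian.
  by congr (`|_| <= _); ring.
have := W x; set F := sup_norm (derive1 (derive1 f)); set G := sup_norm g.
have F0 : (0 <= F)%E by apply: le_trans (sup_norm_ub _ 0); rewrite lee_fin.
have G0 : (0 <= G)%E by apply: le_trans (sup_norm_ub _ 0); rewrite lee_fin.
have fF y : (`|derive1 (derive1 f) y|%:E <= F)%E by exact: sup_norm_ub.
have gG : (`|g x|%:E <= G)%E by exact: sup_norm_ub.
rewrite ltNge => /negP; apply.
(* By the convention 0 * +oo = 0 the bound is 0 here even if [g] is unbounded; Taylor's estimate
   with [M = 0] then makes the Wronskian vanish. *)
have [F00|Fn0] := eqVneq F 0%E.
  rewrite F00 mule0 mul0e lee_fin.
  apply: le_trans (Wr 0 _) _; last by rewrite mul0r mul0r.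
  by move=> y; rewrite -lee_fin; have := fF y; rewrite F00.
have [gx0|gx0] := eqVneq (g x) 0.
  have -> : wronskian f g x = 0.
    rewrite /wronskian gx0 mulr0 subr0; move: E; rewrite gx0 addr0 mulrDl mul1r.
    by move/(congr1 (fun z => z - f x)); rewrite subrr addrAC subrr add0r.
  by rewrite normr0 !mule_ge0 ?expe_ge0// lee_fin.
(* From here both norms are positive, so an infinite one makes the whole bound infinite. *)
have {}G0 : (0 < G)%E by apply: lt_le_trans gG; rewrite lte_fin normr_gt0.
have {}F0 : (0 < F)%E by rewrite lt_def Fn0.
case: G G0 gG => [G| |//] G0 gG; last first.
  by rewrite expe2 mulyy gt0_muley ?leey// mule_gt0// lte_fin invr_gt0.
case: F F0 fF {Fn0} => [F| |//] F0 fF; last first.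
  rewrite gt0_muley ?lte_fin ?invr_gt0// gt0_mulye ?leey//.
  by rewrite expe_gt0.
rewrite -EFin_expe -!EFinM lee_fin.
apply: le_trans (Wr F _) _; first by move=> y; rewrite -lee_fin.
have gG2 : g x ^+ 2 <= G ^+ 2.
  by rewrite -real_normK ?num_real// ler_sqr ?nnegrE// ltW.
by rewrite (mulrC F) ler_wpM2l// mulr_ge0// ltW.
Qed.

(** * Counting paths *)

Section counting_path_facts.
Variables (R : realType) (w : Omega R).

Lemma N_homo (s t : R) : s <= t -> (N s w <= N t w)%N.
Proof. exact: path_val_homo. Qed.

(** If the value at [t] is taken at some earlier time, monotonicity freezes the path up to [t].
    Otherwise every earlier value is strictly smaller, and the unit-jump axiom makes the gap exactly
    one. *)
Lemma N_left_cases (t : R) : jump_times w t \/ \forall s \near t^'-, N s w = N t w.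
Proof.
have [[s0 [s0t E]]|H] := pselect (exists s, s < t /\ N s w = N t w).
  right; near=> s; apply/eqP; rewrite eqn_leq; apply/andP; split.
    by apply: N_homo; apply: ltW; near: s; exact: nbhs_left_lt.
  rewrite -E; apply: N_homo; apply: ltW; near: s; exact: nbhs_left_gt.
left; rewrite /jump_times/=; have := path_val_unit w t => U; near=> s.
have st : s < t by near: s; exact: nbhs_left_lt.
apply/eqP; rewrite eqn_leq; apply/andP; split.
  by near: s.
rewrite ltn_neqAle N_homo ?(ltW st)// andbT; apply/eqP => E.
by apply: H; exists s.
Unshelve. all: by end_near. Qed.

Lemma N_lt_jump (s t : R) : s < t -> jump_times w t -> (N s w < N t w)%N.
Proof.
move=> st /= Jt; near t^'- => u.
have -> : N t w = (N u w).+1 by near: u.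
by rewrite ltnS; apply: N_homo; apply: ltW; near: u; exact: nbhs_left_gt.
Unshelve. all: by end_near. Qed.

Lemma jump_times_cst (s t : R) : s <= t -> N s w = N t w ->
  jump_times w `&` `]0, t] = jump_times w `&` `]0, s].
Proof.
move=> st E; apply/seteqP; split => r /= [Jr]; rewrite !in_itv/= => /andP[r0 rt].
  split => //; rewrite r0/= leNgt; apply/negP => sr.
  have := N_lt_jump sr Jr; rewrite E ltnNge N_homo//.
by split => //; rewrite r0/= (le_trans rt).
Qed.

Lemma jump_times_succ (s t : R) : 0 < t -> s < t -> jump_times w t ->
  N t w = (N s w).+1 ->
  jump_times w `&` `]0, t] = (jump_times w `&` `]0, s]) `|` [set t].
Proof.
move=> t0 st Jt E; apply/seteqP; split => r /=; rewrite !in_itv/=.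
  move=> [Jr /andP[r0]]; rewrite le_eqVlt => /predU1P[->|rt]; first by right.
  left; split => //; rewrite r0/= leNgt; apply/negP => sr.
  have H := N_lt_jump sr Jr; have := N_lt_jump rt Jt; rewrite E ltnS.
  by move/(leq_trans H); rewrite ltnn.
move=> [[Jr /andP[r0 rs]]|->]; last by rewrite t0 lexx.
by split => //; rewrite r0/= (le_trans rs)// ltW.
Qed.

(** The count increases strictly along jump times, hence is injective on them, and is bounded by
    [N t w]. *)
Lemma finite_jump_times (t : R) : finite_set (jump_times w `&` `]0, t]).
Proof.
have inj : {in jump_times w `&` `]0, t] &, injective (fun s => N s w)}.
  move=> r s; rewrite !inE => -[Jr _] [Js _] E.
  have [rs|sr|//] := ltgtP r s.
    by have := N_lt_jump rs Js; rewrite E ltnn.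
  by have := N_lt_jump sr Jr; rewrite E ltnn.
rewrite -(eq_finite_set (inj_card_eq inj)).
apply: (@sub_finite_set _ _ `I_(N t w).+1); last exact: finite_II.
move=> _ [s [_ /=] + <-]; rewrite in_itv/= => /andP[_ st].
by rewrite ltnS; exact: N_homo.
Qed.

(** Take the first time [s] at which the count reaches [N t w]. Right-continuity shows that it is
    attained, and minimality rules out a path constant just before [s]. *)
Lemma last_jump (t : R) : (1 <= N t w)%N ->
  exists s, [/\ 0 < s, s <= t, jump_times w s & N s w = N t w].
Proof.
move=> Nt; pose A := [set s : R | (N t w <= N s w)%N].
have lbA : lbound A 0.
  move=> s As; rewrite leNgt; apply/negP => s0; move: As; rewrite /A/= leqNgt.
  by rewrite /N (path_val0 w (ltW s0)) Nt.
have At : A t by rewrite /A/=.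
have hA : has_inf A by split; [exists t|exists 0].
pose s := inf A.
have st : s <= t by apply: ge_inf => //; exists 0.
have As : A s.
  have rc := path_val_right w s.
  have : \forall u \near s^'+, N u w = N s w by [].
  move=> [e /= e0 He].
  have [u Au us] := inf_adherent e0 hA.
  have [su|] := ltP s u; last first.
    by move=> us'; rewrite /A/=; apply: leq_trans Au _; exact: N_homo.
  rewrite /A/= -(He u)//= distrC gtr0_norm ?subr_gt0// ltrBlDl//.
have s0 : 0 < s.
  by rewrite ltNge; apply/negP => s0; move: As; rewrite /A/= /N (path_val0 w s0) leqNgt Nt.
have NE : N s w = N t w by apply/eqP; rewrite eqn_leq N_homo.
exists s; split => //.
have [//|H] := N_left_cases s; exfalso.
near s^'- => u.
have us : u < s by near: u; exact: nbhs_left_lt.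
have Nu : N u w = N s w by near: u.
have : s <= u by apply: ge_inf; [exists 0|rewrite /A/= Nu NE].
by rewrite leNgt us.
Unshelve. all: by end_near. Qed.

End counting_path_facts.

(** * Cadlag functions *)

Lemma measurable_fun_floor (R : realType) (c : R) (v : int -> R) (D : set R) :
  measurable_fun D (fun t : R => v (Num.floor (t * c))).
Proof.
move=> mD B mB; apply: measurableI => //.
have -> : (fun t : R => v (Num.floor (t * c))) @^-1` B =
    \bigcup_(k in [set k | B (v k)]) ( *%R^~ c @^-1` `[k%:~R, (k + 1)%:~R[).
  apply/seteqP; split => t /=.
    move=> Bt; exists (Num.floor (t * c)) => //=; rewrite in_itv/=; exact: floor_itv.
  by move=> [k /= Bk]; rewrite in_itv/= => /floor_def ->.
rewrite bigcup_mkcond; apply: countable_bigcupT_measurable => // k.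
case: ifP => // _; rewrite -[X in measurable X]setTI.
by apply: mulrr_measurable.
Qed.

Section cadlag.
Variables (R : realType) (T : R) (x : R -> R).
Hypothesis xc : cadlag_on T x.

Lemma cadlag_bounded : exists M, forall t, 0 <= t <= T -> `|x t| <= M.
Proof.
have loc t : 0 <= t <= T -> exists C, \forall s \near t, 0 <= s <= T -> `|x s| <= C.
  move=> /andP[t0 tT].
  have [C1 [e1 /= e10 H1]] : exists C, \forall s \near t^'+, 0 <= s <= T -> `|x s| <= C.
    move: tT; rewrite le_eqVlt => /predU1P[->|tT].
      exists 0; near=> s => /andP[_]; rewrite leNgt => /negP; case.
      by near: s; exact: nbhs_right_gt.
    have /xc.1 H : 0 <= t < T by rewrite t0.
    exists (`|x t| + 1); near=> s => _; near: s.
    by apply: cvgr_norm_le H _ _; rewrite ltrDl.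
  have [C2 [e2 /= e20 H2]] : exists C, \forall s \near t^'-, 0 <= s <= T -> `|x s| <= C.
    move: t0; rewrite le_eqVlt => /predU1P[<-|t0].
      exists 0; near=> s => /andP[+ _]; rewrite leNgt => /negP; case.
      by near: s; exact: nbhs_left_lt.
    have /xc.2 /cvg_ex[l H] : 0 < t <= T by rewrite t0.
    exists (`|l| + 1); near=> s => _; near: s.
    by apply: cvgr_norm_le H _ _; rewrite ltrDl.
  exists (Num.max (Num.max C1 C2) `|x t|).
  exists (Num.min e1 e2); rewrite /= ?lt_min ?e10//.
  move=> s; rewrite /ball_/= lt_min => /andP[s1 s2] sT; rewrite !le_max.
  have [ts|st|->] := ltgtP t s; last by rewrite lexx orbT.
    by rewrite H1.
  by rewrite H2// orbT.
(* Near-covering compactness along [M] tending to infinity merges the local bounds into one. *)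
have := @segment_compact R 0 T; move/compact_near_coveringP.
move/(_ _ (pinfty_nbhs R) (fun M t => 0 <= t <= T -> `|x t| <= M) _) => H.
have [|M [_ HM]] := H.
  move=> t /=; rewrite in_itv/= => /loc[C HC].
  exists ([set s | 0 <= s <= T -> `|x s| <= C], [set M | C <= M]).
    split => //=; exact: nbhs_pinfty_ge (num_real C).
  by move=> [s M] /= [sC CM] sT; exact: le_trans (sC sT) CM.
exists (M + 1) => t tT; apply: (HM (M + 1)) => //; rewrite ?ltrDl//= in_itv//.
Unshelve. all: by end_near. Qed.

Lemma cadlag_measurable : measurable_fun `[0, T] x.
Proof.
(* The first grid point strictly to the right of [t], capped at [T]. Right-continuity is available
   only before [T]; at [T] the cap makes the approximation exact. *)
pose d n (k : int) := Num.min T ((k + 1)%:~R / n.+1%:R).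
refine (@measurable_fun_cvg _ _ R `[0, T]
  (fun n t => x (d n (Num.floor (t * n.+1%:R)))) x _ _).
  by move=> n; apply: (measurable_fun_floor _ (x \o d n)).
move=> t /=; rewrite in_itv/= => /andP[t0 tT].
have dt n : t < (Num.floor (t * n.+1%:R) + 1)%:~R / n.+1%:R.
  by rewrite ltr_pdivlMr//; have /andP[] := floor_itv (t * n.+1%:R).
have dt2 n : (Num.floor (t * n.+1%:R) + 1)%:~R / n.+1%:R <= t + n.+1%:R^-1.
  rewrite ler_pdivrMr// mulrDl mulVf// intrD lerD2r.
  by have /andP[] := floor_itv (t * n.+1%:R).
move: tT; rewrite le_eqVlt => /predU1P[tT|tT].
  apply: cvg_near_cst; apply: nearW => n; have -> : d n (Num.floor (t * n.+1%:R)) = T.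
    by apply/min_idPl; rewrite -{1}tT; exact: ltW.
  by rewrite tT.
have /xc.1 H : 0 <= t < T by rewrite t0.
have dcv : d n (Num.floor (t * n.+1%:R)) @[n --> \oo] --> t^'+.
  move=> A [e /= e0 He].
  suff : \forall n \near \oo, A (d n (Num.floor (t * n.+1%:R))) by [].
  near=> n; apply: He.
    have td : t < d n (Num.floor (t * n.+1%:R)) by rewrite /d lt_min tT dt.
    rewrite /= distrC gtr0_norm ?subr_gt0// ltrBlDl.
    apply: (@le_lt_trans _ _ (t + n.+1%:R^-1)).
      by rewrite /d ge_min dt2 orbT.
    rewrite ltrD2l.
    by near: n; exact: (near_infty_natSinv_lt (PosNum e0)).
  by rewrite /d lt_min tT dt.
exact: cvg_comp dcv H.
Unshelve. all: by end_near. Qed.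

End cadlag.

(** * Paths of the equation *)

Section sde_path.
Variables (R : realType) (T : R) (f g : R -> R) (x0 K : R) (phi : R -> R -> R).
Variables (w : Omega R) (x : R -> R).
Hypothesis fK : forall u v, `|f u - f v| <= K * `|u - v|.
Hypothesis phiP : is_flow f phi.
Hypothesis xc : cadlag_on T x.
Hypothesis xE : forall t : R, 0 <= t <= T ->
       x t = x0 + (\int[lebesgue_measure]_(s in `[0, t]) f (x s))%R
         + int_dN `]0, t] (fun s => g (lim (x u @[u --> s^'-]))) w.

Let cf : continuous f := lipschitz_continuous fK.

Lemma sde_integrable : lebesgue_measure.-integrable `[0, T] (EFin \o (f \o x)).
Proof.
have [M HM] := cadlag_bounded xc.
apply: measurable_bounded_integrable => //.
- by rewrite /= lebesgue_measure_itv/=; case: ifP => // _; rewrite -EFinB ltry.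
- apply: measurableT_comp; last exact: cadlag_measurable.
  exact: continuous_measurable_fun.
- exists (`|f 0| + K * M); split; first exact: num_real.
  move=> C MC t /=; rewrite in_itv/= => /HM xM.
  apply: le_trans (ltW MC); rewrite -[f (x t)](subrK (f 0)) addrC.
  apply: le_trans (ler_normD _ _) _; rewrite lerD2l.
  apply: le_trans (fK _ _) _; rewrite subr0 ler_wpM2l//.
  by have := fK 1 0; rewrite subr0 normr1 mulr1; apply: le_trans.
Qed.

Let F t := (\int[lebesgue_measure]_(s in `[0, t]) f (x s))%R.
Let J t := int_dN `]0, t] (fun s => g (lim (x u @[u --> s^'-]))) w.

Let FB (s t : R) : 0 <= s -> s <= t -> t <= T ->
  F t - F s = (\int[lebesgue_measure]_(u in `[s, t]) f (x u))%R.
Proof.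
move=> s0 st tT; rewrite /F Rintegral_itvB ?bnd_simp//.
  rewrite Rintegral_itv_obnd_cbnd//; apply: integrableS sde_integrable => //.
  by apply: subset_itv; rewrite bnd_simp.
by apply: integrableS sde_integrable => //; apply: subset_itvl; rewrite bnd_simp.
Qed.

(** The jump terms cancel, so [x] coincides with the primitive [y] and is continuous; then [f \o x]
    is continuous, the integral equation becomes a differential one, and uniqueness of the flow
    applies. *)
Lemma sde_path_no_jump (s t : R) : 0 <= s -> s <= t -> t <= T -> N s w = N t w ->
  x t = phi (t - s) (x s).
Proof.
move=> s0; rewrite le_eqVlt => /predU1P[-> _ _|st tT NE].
  by rewrite subrr (flow0 phiP).
pose y (r : R) : R := x s + (\int[lebesgue_measure]_(u in `[s, r]) f (x u))%R.
have ist : lebesgue_measure.-integrable `[s, t] (EFin \o (f \o x)).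
  by apply: integrableS sde_integrable => //; apply: subset_itv; rewrite bnd_simp.
have xy r : s <= r <= t -> x r = y r.
  move=> /andP[sr rt]; rewrite /y -FB//; last exact: le_trans tT.
  rewrite xE ?(le_trans s0 sr) ?(le_trans rt tT)// (@xE s) ?s0 ?(le_trans (ltW st) tT)//.
  rewrite /int_dN (jump_times_cst sr); last first.
    by apply/eqP; rewrite eqn_leq N_homo//= NE N_homo.
  rewrite -/(F r) -/(F s); ring.
have cy : {within `[s, t], continuous y}.
  move=> r; apply: cvgD; first exact: cvg_cst.
  exact: (parameterized_integral_continuous (ltW st) ist).
have dy (r : R) : s < r < t -> is_derive r 1 y (f (y r)).
  move=> /andP[sr rt].
  have cr : {for r, continuous (f \o x)}.
    apply: continuous_comp; last exact: cf.
    have := within_continuous_continuous st cy; rewrite /= => /(_ r).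
    rewrite in_itv/= sr rt => /(_ isT) cyr.
    have xr : x r = y r by rewrite xy// !ltW.
    rewrite /prop_for/continuous_at xr; apply: cvg_trans cyr; apply: near_eq_cvg.
    near=> u; rewrite xy//; apply/andP; split; apply: ltW; near: u.
      exact: lt_nbhsr.
    exact: lt_nbhsl.
  have [d1 d2] := continuous_FTC1_closed rt ist sr cr.
  have dI : is_derive r 1
      (fun r => \int[lebesgue_measure]_(u in `[s, r]) (f \o x) u)%R (f (x r)).
    by apply: DeriveDef; [exact: d1|rewrite -derive1E; exact: d2].
  have H := is_deriveD (is_derive_cst (x s) r 1) dI.
  by apply: (is_derive_eq H); rewrite add0r xy// !ltW.
rewrite (xy t) ?lexx ?(ltW st)// (flow_unique fK phiP (ltW st) cy dy).
by rewrite -xy// lexx ltW.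
Unshelve. all: by end_near. Qed.

(** The Lebesgue integral is left-continuous, so the gap between [x s] and its left limit is the
    increment of the jump sum over []u, s]], which is constant for [u] close to [s]. *)
Lemma sde_left_limit (s : R) : 0 < s <= T ->
  exists l, [/\ x u @[u --> s^'-] --> l,
    jump_times w s -> x s = l + g l & ~ jump_times w s -> x s = l].
Proof.
move=> sT; have /andP[s0 sleT] := sT.
have xl := xc.2 _ sT; set l := lim (x u @[u --> s^'-]) in xl *.
have cF : F u @[u --> s^'-] --> F s.
  apply: parameterized_integral_cvg_at_left s0 _.
  by apply: integrableS sde_integrable => //; apply: subset_itvl; rewrite bnd_simp.
have sI : 0 <= s <= T by rewrite ltW.
have key c : (\forall u \near s^'-, J s - J u = c) -> x s = l + c.
  move=> Jc.
  have : x u @[u --> s^'-] --> x s - c - (F s - F s).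
    have : (x s - c - (F s - F u)) @[u --> s^'-] --> x s - c - (F s - F s).
      by apply: cvgB; [exact: cvg_cst|apply: cvgB => //; exact: cvg_cst].
    apply: cvg_trans; apply: near_eq_cvg; near=> u.
    have <- : J s - J u = c by near: u.
    have us : u <= s by apply: ltW; near: u; exact: nbhs_left_lt.
    have u0 : 0 <= u by apply: ltW; near: u; exact: nbhs_left_gt.
    rewrite (xE sI) xE ?u0 ?(le_trans us)// -/(F s) -/(F u) -/(J s) -/(J u); ring.
  rewrite subrr subr0 => H.
  have -> : l = x s - c by apply: cvg_lim H.
  by rewrite subrK.
exists l; split => // Js.
- apply: key; have Jn : \forall u \near s^'-, N s w = (N u w).+1 := Js.
  near=> u.
  have us : u < s by near: u; exact: nbhs_left_lt.
  have Nu : N s w = (N u w).+1 by near: u.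
  rewrite /J /int_dN (jump_times_succ s0 us Js Nu) fsbigU//=.
  + by rewrite fsbig_set1 addrC addrK.
  + exact: finite_jump_times.
  + move=> r [[_ +] /= rs]; rewrite rs /= in_itv/= => /andP[_].
    by rewrite leNgt us.
- rewrite (key 0) ?addr0//; case: (N_left_cases w s) => // Jn.
  near=> u.
  have us : u <= s by apply: ltW; near: u; exact: nbhs_left_lt.
  have Nu : N u w = N s w by near: u.
  by rewrite /J /int_dN (jump_times_cst us Nu) subrr.
Unshelve. all: by end_near. Qed.

End sde_path.

(** * Landing points *)

Section landing.
Variables (R : realType) (T : R) (f g g' : R -> R) (x0 K : R) (phi : R -> R -> R).
Variables (w : Omega R) (x : R -> R).
Hypothesis fK : forall u v, `|f u - f v| <= K * `|u - v|.
Hypothesis phiP : is_flow f phi.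
Hypothesis dg : forall y : R, is_derive y 1 g (g' y).
Hypothesis cg' : continuous g'.
Hypothesis q0 : forall y, (1 + g' y) * f y != f (y + g y).
Hypothesis xc : cadlag_on T x.
Hypothesis xE : forall t : R, 0 <= t <= T ->
       x t = x0 + (\int[lebesgue_measure]_(s in `[0, t]) f (x s))%R
         + int_dN `]0, t] (fun s => g (lim (x u @[u --> s^'-]))) w.

(* The value of the solution at time [T] if [t] is a jump time, [x t] the
   value just before it, and there is no jump after [t]. *)
Definition landing (t : R) := phi (T - t) (x t + g (x t)).

Let cg : continuous g := is_derive_continuous dg.

Let K0 : 0 <= K.
Proof. by have := fK 1 0; rewrite subr0 normr1 mulr1; apply: le_trans. Qed.

(** At a jump time [landing s] would apply the jump twice; its left limit applies it once, to the
    state before the jump. Elsewhere the two agree. *)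
Lemma landing_left_limit (s : R) : 0 < s <= T ->
  exists l, [/\ landing u @[u --> s^'-] --> l,
    jump_times w s -> l = phi (T - s) (x s) & ~ jump_times w s -> l = landing s].
Proof.
move=> sT; have [l [xl xJ xnJ]] := sde_left_limit fK xc xE sT.
exists (phi (T - s) (l + g l)); split.
- apply: (flow_cvg fK phiP).
  + near=> u; rewrite subr_ge0; apply: (@le_trans _ _ s); last by case/andP: sT.
    by apply: ltW; near: u; exact: nbhs_left_lt.
  + apply: cvgB; first exact: cvg_cst.
    exact: cvg_at_left_filter cvg_id.
  + by apply: cvgD => //; apply: cvg_comp xl _; exact: cg.
- by move=> /xJ ->.
- by move=> /xnJ xs; rewrite /landing xs.
Unshelve. all: by end_near. Qed.

Lemma landing_expands (s : R) : 0 < s <= T ->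
  exists2 c, 0 < c &
    \forall t \near s^'+, t <= T -> N t w = N s w ->
      c * (t - s) <= `|landing t - landing s|.
Proof.
move=> /andP[s0 sT].
have dh (y : R) : is_derive y 1 (id + g) (1 + g' y) by apply: is_deriveD.
have ch : continuous (fun y => 1 + g' y).
  by move=> y; apply: cvgD; [exact: cvg_cst|exact: cg'].
have [c c0 [e /= e0 He]] :=
  flow_commutator_expands phiP (lipschitz_continuous fK) ch dh (q0 (x s)).
(* [c] is the rate at which the commutator opens up at time [t]; at most a factor [expR (K * T)] is
   lost by flowing on to [T]. *)
exists (c / expR (K * T)); first by rewrite divr_gt0// expR_gt0.
exists e => //= t; rewrite /ball_/= => ste st tT NE.
have d0 : 0 < t - s by rewrite subr_gt0.
have := He (t - s); rewrite /ball_/= sub0r normrN -normrN opprB => /(_ ste d0).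
rewrite /GRing.add/= -!/(GRing.add _ _) => H.
have xt : x t = phi (t - s) (x s).
  by apply: (sde_path_no_jump fK phiP xc xE) => //; exact: ltW.
have Ls : landing s = phi (T - t) (phi (t - s) (x s + g (x s))).
  rewrite -(flowD fK phiP) ?subr_ge0 ?(ltW st)// /landing; congr (phi _ _); ring.
have tT0 : 0 <= T - t by rewrite subr_ge0.
have [_] := flow_lipschitz fK phiP (phi (t - s) (x s + g (x s))) (x t + g (x t)) tT0.
rewrite -Ls -/(landing t) => H2.
rewrite mulrAC ler_pdivrMr ?expR_gt0//; rewrite -xt in H.
apply: le_trans H (le_trans H2 _).
rewrite distrC mulrC ler_wpM2l// ler_expR ler_wpM2l//.
by rewrite gerBl (le_trans (ltW s0))// ltW.
Qed.

Lemma negligible_landing (B : set R) : lebesgue_measure.-negligible B ->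
  lebesgue_measure.-negligible
    [set s | 0 < s <= T /\ B (lim (landing u @[u --> s^'-]))].
Proof.
move=> B0.
(* Two times with the same count have no jump between them, so on each [A k] the expansion estimate
   holds without further condition. The jump times, where [landing] and its left limit differ, form
   a finite set. *)
pose A k := [set s | 0 < s <= T /\ N s w = k].
have sub : [set s | 0 < s <= T /\ B (lim (landing u @[u --> s^'-]))] `<=`
    (jump_times w `&` `]0, T]) `|` \bigcup_k (A k `&` landing @^-1` B).
  move=> s [sT Bs]; have [l [Ll _ LnJ]] := landing_left_limit sT.
  have [Js|nJs] := pselect (jump_times w s); [left|right].
    by split => //=; rewrite in_itv.
  exists (N s w) => //; split => //=.
  by rewrite -(LnJ nJs) -(cvg_lim _ Ll).
refine (@negligibleS _ _ _ (@lebesgue_measure R) _ _ sub _).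
apply: negligibleU.
  apply/negligibleP.
    apply: countable_measurable; first exact: measurable_set1.
    by apply: finite_set_countable; exact: finite_jump_times.
  apply: countable_lebesgue_measure0; apply: finite_set_countable.
  exact: finite_jump_times.
apply: negligible_bigcup => k; apply: negligible_preimage_right_expanding B0.
move=> s [sT Ns]; have [c c0 [e e0 He]] := landing_expands sT.
exists c => //; exists e => // t st0 st [/andP[_ tT] Nt].
by apply: He => //; rewrite Nt Ns.
Qed.

End landing.

(** * Left limits are predictable *)

Section left_limit_process.
Variables (R : realType) (T : R) (Q : R -> Omega R -> R).
Hypothesis T0 : 0 < T.
Hypothesis Qad : forall t, 0 <= t <= T -> forall B : set R, measurable B ->
  natural_filtration t (Q t @^-1` B).

Let PT := g_sigma_algebraType (@predictable_rectangles R).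

Definition strip : set (R * Omega R) := `]0, T] `*` setT.

Lemma measurable_rectangle (B : set (R * Omega R)) : predictable_rectangles B ->
  measurable (B : set PT).
Proof. exact: sub_sigma_algebra. Qed.

Lemma natural_filtrationT (t : R) : natural_filtration t setT.
Proof. by rewrite -setC0 -setTD; apply: sigma_algebraCD; exact: sigma_algebra0. Qed.

Lemma measurable_strip : measurable (strip : set PT).
Proof.
apply: measurable_rectangle; exists 0, T, setT; split => //; first exact: ltW.
exact: natural_filtrationT.
Qed.

(** Taking [ceil - 1] instead of [floor] gives a grid point strictly below [s] even when [s] lies on
    the grid, as predictability demands. *)
Definition left_grid (n : nat) (s : R) : R :=
  (Num.ceil (s * n.+1%:R) - 1)%:~R / n.+1%:R.

Lemma left_grid_lt n s : left_grid n s < s.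
Proof. by rewrite ltr_pdivrMr//; have /andP[] := ceil_itv (s * n.+1%:R). Qed.

Lemma left_grid_ge n s : s <= left_grid n s + n.+1%:R^-1.
Proof.
rewrite -[n.+1%:R^-1]mul1r -mulrDl ler_pdivlMr// intrD subrK.
by have /andP[] := ceil_itv (s * n.+1%:R).
Qed.

Lemma cvg_left_grid s : left_grid n s @[n --> \oo] --> s^'-.
Proof.
move=> A [e /= e0 He].
suff : \forall n \near \oo, A (left_grid n s) by [].
near=> n; apply: He; last exact: left_grid_lt.
rewrite /= gtr0_norm ?subr_gt0 ?left_grid_lt// ltrBlDl.
apply: le_lt_trans (left_grid_ge n s) _; rewrite ltrD2l.
by near: n; exact: (near_infty_natSinv_lt (PosNum e0)).
Unshelve. all: by end_near. Qed.

Definition left_approx (n : nat) (p : PT) : R :=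
  if 0 < p.1 <= T then Q (left_grid n p.1) p.2 else 0.

Lemma measurable_left_approx n : measurable_fun setT (left_approx n).
Proof.
move=> _ B mB; rewrite setTI.
pose c k : R := k%:R / n.+1%:R.
(* On []c k, c k.+1]] the grid point is [c k], so each piece is a rectangle whose base is an event
   known at its left end; off the strip the default value 0 decides. *)
have -> : left_approx n @^-1` B =
    (if 0 \in B then ~` strip else set0) `|`
    \bigcup_(k in [set k | c k <= T])
      (`]c k, Num.min T (c k.+1)] `*` (Q (c k) @^-1` B)).
  apply/seteqP; split.
    move=> [s w]; rewrite /preimage/left_approx/=.
    case: ifPn => [sT Bs|sT B0]; last first.
      left; rewrite mem_set// /setC/= /strip/= in_itv/= => -[sT' _].
      by rewrite sT' in sT.
    move: sT => /andP[s0 sT].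
    have ck : c `|Num.ceil (s * n.+1%:R) - 1|%N = left_grid n s.
      rewrite /c /left_grid natr_absz ger0_norm// subr_ge0 -gtz0_ge1 ceil_gt0 mulr_gt0//.
    right; exists `|Num.ceil (s * n.+1%:R) - 1|%N; rewrite /= ck.
      exact: ltW (lt_le_trans (left_grid_lt n s) sT).
    split => //=; rewrite in_itv/= left_grid_lt le_min sT/=.
    have -> : forall k, c k.+1 = c k + n.+1%:R^-1.
      by move=> k; rewrite /c -addn1 natrD mulrDl mul1r.
    by rewrite ck left_grid_ge.
  move=> [s w] []; rewrite /preimage/left_approx/=.
    case: ifPn => // /[!inE] B0; rewrite /strip/= in_itv/= => sT.
    by rewrite ifN//; apply/negP => s0; apply: sT.
  move=> [k /= ckT] [/=]; rewrite in_itv/= le_min => /andP[cks /andP[sT sck]] Bk.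
  have s0 : 0 < s by apply: le_lt_trans cks; rewrite divr_ge0.
  rewrite s0 sT/=.
  rewrite (_ : left_grid n s = c k)// /left_grid.
  rewrite (@ceil_def _ _ k.+1%:Z)//.
    by rewrite /c intrB -addn1 PoszD rmorphD/= addrK.
  move: cks sck; rewrite /c ltr_pdivrMr// ler_pdivlMr// => cks sck.
  by apply/andP; split; [rewrite -addn1 PoszD addrK|].
apply: measurableU.
  case: ifP => _ //; apply: measurableC; exact: measurable_strip.
apply: bigcup_measurable => k ckT; apply: measurable_rectangle.
have ck0 : 0 <= c k by rewrite divr_ge0.
exists (c k), (Num.min T (c k.+1)), (Q (c k) @^-1` B); split => //.
- by rewrite le_min ckT/= ler_pM2r// ler_nat.
- by apply: Qad => //; rewrite ck0.
Qed.

(** The upper limit of the approximations is measurable even where they diverge. This matters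
    because left limits of the solution exist only almost surely. *)
Lemma left_limit_predictable : exists U : R * Omega R -> R, predictable U /\
  forall s w l, 0 < s <= T -> Q u w @[u --> s^'-] --> l -> U (s, w) = l.
Proof.
exists (fun p => fine (limn_esup (fun n => (left_approx n p)%:E))); split.
  apply: measurableT_comp => //.
  apply: measurable_fun_limn_esup => n; apply/measurable_EFinP.
  exact: measurable_left_approx.
move=> s w l sT Ql.
have : (fun n => left_approx n (s, w)) @ \oo --> l.
  have -> : (fun n => left_approx n (s, w)) = (fun n => Q (left_grid n s) w).
    by apply/funext => n; rewrite /left_approx/= sT.
  exact: (cvg_comp (left_grid ^~ s) (fun u => Q u w) (@cvg_left_grid s) Ql).
move=> H; have {}H : (left_approx n (s, w))%:E @[n --> \oo] --> l%:E.
  by apply/fine_cvgP; split; [exact: nearW|exact: H].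
by rewrite is_cvg_limn_esupE; [rewrite (cvg_lim _ H)|apply/cvg_ex; exists l%:E].
Qed.

End left_limit_process.

(** * Absolute continuity *)

Lemma predictable_hitting_null (R : realType) (T : R) (P : probability (Omega R) R)
    (l U : R -> Omega R -> R) (X : Omega R -> R) (B : set R) (M : set (Omega R)) :
  has_intensity P l ->
  predictable (fun p => U p.1 p.2) ->
  P.-negligible M -> measurable B ->
  (forall w, ~ M w ->
    lebesgue_measure.-negligible [set s | 0 < s <= T /\ B (U s w)]) ->
  (forall w, ~ M w -> (1 <= N T w)%N ->
    exists s, [/\ 0 < s <= T, jump_times w s & U s w = X w]) ->
  measurable (X @^-1` B `&` [set w | (1 <= N T w)%N]) ->
  P (X @^-1` B `&` [set w | (1 <= N T w)%N]) = 0%E.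
Proof.
move=> Nl pU [M' [mM' M'0 MM']] mB UB UJ mXB.
set A := _ `&` _ in mXB *.
pose S : set (R * Omega R) := strip T `&` (fun p => U p.1 p.2) @^-1` B.
have SE s w : S (s, w) <-> 0 < s <= T /\ B (U s w).
  by rewrite /S /strip /setI/= in_itv/=; split => [[[]]|[]].
pose C : R * Omega R -> R := \1_S.
have T0 : 0 < T -> predictable C.
  move=> T0; apply: measurable_indic; apply: measurableI; first exact: measurable_strip.
  by rewrite -[X in measurable X]setTI; exact: pU.
have [T0'|T0'] := ltP 0 T; last first.
  have -> : A = set0; last by rewrite measure0.
  rewrite -subset0 => w [_] /=; rewrite /N (path_val0 w T0'); by [].
have C0 z : 0 <= C z by rewrite /C indicE.
have := Nl C (T0 T0') C0.
(* Off [M'] the inner integral vanishes whatever the intensity: [C] is zero outside a null set of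
   times. *)
rewrite [RHS](@integral_eq0_negligible _ _ _ P _ M'); last 2 first.
- by exists M'; split.
- move=> w _ M'w; have Mw : ~ M w by move=> /MM'.
  apply: integral_eq0_negligible (UB _ Mw) _ => s _ /= nS.
  rewrite /C indicE memNset ?mul0r//; first by move/SE.
move=> E.
have A0 : P (A `\` M') = 0%E.
  apply: measure_eq0_of_integral_eq0 E _ _.
  - by move=> w; apply: esum_ge0 => s _; rewrite lee_fin.
  - exact: measurableD.
  (* The one jump time supplied by [UJ] already contributes 1 to the sum. *)
  - move=> w [[XB NT] M'w]; have Mw : ~ M w by move=> /MM'.
    have [s [sT Js Us]] := UJ _ Mw NT.
    apply: esum_ge; exists [set s].
      by split => // _ ->.
    rewrite fsbig_set1 /C indicE mem_set//.
    by apply/SE; split => //; rewrite Us.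
apply/eqP; rewrite -measure_le0 -[leRHS]adde0 -{1}A0 -M'0.
apply: le_trans (measureU2 _ _ _) => //; last exact: measurableD.
apply: le_measure; rewrite ?inE//.
  by apply: measurableU => //; exact: measurableD.
by move=> w Aw; have [?|?] := pselect (M' w); [right|left].
Qed.

Theorem corollary5p11 (R : realType) (T : R) (P : probability (Omega R) R)
    (lam mu gamma : R -> R) (f g : R -> R) (x0 : R) (X : R -> Omega R -> R)
    (T_gt0 : 0 < T)
    (hawkes_coef : hawkes_coefficients lam mu gamma)
    (N_hawkes : has_intensity P (hawkes_intensity lam mu gamma))
    (sde_coef : sde_coefficients f g)
    (X_sol : sde_solution P T f g x0 X)
    (f_C2 : C2 f)
    (W_gt : forall x : R,
      ((2^-1)%:E * sup_norm (derive1 (derive1 f)) * (sup_norm g) ^+ 2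
         < `|wronskian f g x|%:E)%E) :
  cond_law P [set w | (1 <= N T w)%N] (X T) `<< lebesgue_measure.
Proof.
have [[f1 f1'] _] := f_C2.
have [dg cg'] := sde_g_C1 sde_coef.
have dg1 := derivable_is_derive1 dg.
have [K0 K0f] := sde_f_bounded sde_coef.
(* Made strictly positive because the weights of the Picard iteration divide by [K]. *)
pose K := `|K0| + 1.
have Kgt0 : 0 < K by rewrite ltr_wpDl.
have fK : forall u v, `|f u - f v| <= K * `|u - v|.
  apply: lipschitz_of_derive1; first by split.
  move=> x; apply: le_trans (K0f x) _; apply: le_trans (ler_norm _) _.
  by rewrite lerDl.
have [phi phiP] := flow_exists Kgt0 fK.
have q0 := wronskian_jump_neq f_C2 W_gt.
have cg := is_derive_continuous dg1.
have [Xad Xae] := X_sol.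
pose Q t w := landing T g phi (fun t => X t w) t.
have Qad t : 0 <= t <= T -> forall B : set R, measurable B ->
    natural_filtration t (Q t @^-1` B).
  move=> tT B mB.
  have -> : Q t @^-1` B =
    X t @^-1` ((fun z => phi (T - t) (z + g z)) @^-1` B) by [].
  apply: Xad => //; rewrite -[X in measurable X]setTI.
  have cz : continuous (fun z => phi (T - t) (z + g z)).
    move=> z; apply: (@continuous_comp _ _ _ (fun z => z + g z) (phi (T - t))).
      by apply: cvgD; [exact: cvg_id|exact: cg].
    have tT0 : 0 <= T - t by rewrite subr_ge0; case/andP: tT.
    apply: (@lipschitz_continuous _ _ (expR (K * (T - t)))) => u v.
    by have [] := flow_lipschitz fK phiP u v tT0.
  exact: (continuous_measurable_fun cz).
have [U [pU UQ]] := left_limit_predictable T_gt0 Qad.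
case: Xae => M' [mM' M'0 sM'].
move=> A A0 B mB BA; rewrite /cond_law.
have B0 : lebesgue_measure.-negligible B.
  by exists B; split => //; exact: A0.
have path w : ~ M' w -> cadlag_on T (fun t => X t w) /\
     forall t, 0 <= t <= T ->
       X t w = x0 + (\int[lebesgue_measure]_(s in `[0, t]) f (X s w))%R
         + int_dN `]0, t] (fun s => g (lim (X u w @[u --> s^'-]))) w.
  by move=> nM; apply: contrapT => H; apply: nM; exact: sM'.
have UL w s : ~ M' w -> 0 < s <= T -> exists l,
    [/\ Q u w @[u --> s^'-] --> l, U (s, w) = l &
        jump_times w s -> U (s, w) = phi (T - s) (X s w)].
  move=> /path[Xc XE] sT.
  have [l [Ql lJ _]] := landing_left_limit fK phiP dg1 Xc XE sT.
  by exists l; rewrite (UQ _ _ _ sT Ql).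
(* Only the numerator of the conditional law has to vanish, since 0 times any extended real is 0. *)
rewrite (@predictable_hitting_null _ T _ _ (fun s w => U (s, w)) _ _ M' N_hawkes).
- by rewrite mul0e.
- by apply: eq_measurable_fun pU => -[].
- by exists M'; split.
- by [].
- move=> w nM; have [Xc XE] := path w nM.
  have := negligible_landing fK phiP dg1 cg' q0 Xc XE B0.
  apply: (@negligibleS _ _ _ (@lebesgue_measure R)) => s [sT Bs]; split => //.
  by have [l [/cvg_lim -> // <- _]] := UL w s nM sT.
- move=> w nM NT; have [Xc XE] := path w nM.
  have [s [s0 sT Js NE]] := last_jump NT.
  exists s; split => //; first by rewrite s0.
  have [|l [_ _ ->//]] := UL w s nM; first by rewrite s0.
  apply/esym; apply: (sde_path_no_jump fK phiP Xc XE) => //; exact: ltW.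
- apply: measurableI.
    have := Xad T; rewrite lexx ltW// => /(_ isT B mB).
    apply: sub_sigma_algebra2 => _ [t [k [_ ->]]]; by exists t, k.
  rewrite [X in measurable X](_ : _ = ~` [set w | path_val w T = 0%N]).
    apply: measurableC; apply: sub_sigma_algebra; by exists T, 0%N.
  by apply/seteqP; split => w /=; rewrite lt0n => /eqP.
Qed.
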